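(* Let $k$ be a perfect field of characteristic $p>0$, $\bm{x}=(x_{i,j})$ an $m\times n$ matrix of indeterminates, $S=k[\bm{x}]$, $\mu=\min\{m,n\}$. Define $\Delta=\alpha_1\cdots\alpha_{\mu-1}\,\delta_1\cdots\delta_{|n-m|+1}\,\beta_{\mu-1}\cdots\beta_1\in S$, where $\alpha_i$ is the $i$-minor of $\bm{x}$ on rows $m-i+1,\dots,m$ and columns $1,\dots,i$; $\beta_i$ is the $i$-minor on rows $1,\dots,i$ and columns $n-i+1,\dots,n$; and the $\delta_j$ are the $\mu$-minors on $\mu$ consecutive columns (if $m\le n$: rows $1,\dots,m$, columns $j,\dots,j+m-1$) or on $\mu$ consecutive rows (if $m\ge n$: rows $i,\dots,i+n-1$, columns $1,\dots,n$), one for each of the $|n-m|+1$ possible positions. Let $\Phi:F_*S\to S$ be the Frobenius trace of $S$ and $\phi=\Phi\circ F_*(\Delta^{p-1}\cdot -)\in\operatorname{Hom}_S(F_*S,S)$. Then $\phi(F_*1)=1$, and for every $2\le t\le\mu$, letting $\bm{x}'$ be the submatrix of the first $t-1$ rows of $\bm{x}$, both $I_t(\bm{x})$ and $I_{t-1}(\bm{x}')$ are $\phi$-compatible, i.e. $\phi(F_*I_t(\bm{x}))\subseteq I_t(\bm{x})$ and $\phi(F_*I_{t-1}(\bm{x}'))\subseteq I_{t-1}(\bm{x}')$.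
   Context: $F_*S$ is $S$ viewed as an $S$-module via Frobenius. Since $k$ is perfect, $F_*S$ is a free $S$-module with basis $F_*\bm{x}^{\bm a}$, $0\le a_{ij}\le p-1$; the Frobenius trace $\Phi$ is the $S$-linear map sending $F_*\prod_{i,j}x_{i,j}^{p-1}$ to $1$ and all other basis monomials to $0$. $I_t(M)$ is the ideal of $t\times t$ minors of $M$. *)

(* Defs.v *)
From HB Require Import structures.
From mathcomp Require Import all_boot all_order all_algebra.
From mathcomp Require Import mpoly.
Set Implicit Arguments. Unset Strict Implicit. Unset Printing Implicit Defensive.
Import Order.TTheory GRing.Theory.
Local Open Scope ring_scope.

Definition xmat (k : fieldType) (m n : nat) : 'M[{mpoly k[m * n]}]_(m, n) :=
  \matrix_(i, j) 'X_(mxvec_index i j).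

Definition entry (R : nzRingType) (m n : nat) (A : 'M[R]_(m, n)) (r c : nat) : R :=
  match @insub _ (fun x => x < m)%N 'I_m r, @insub _ (fun x => x < n)%N 'I_n c with
  | Some i, Some j => A i j
  | _, _ => 0
  end.

(* the s-minor of A on rows r0, ..., r0+s-1 and columns c0, ..., c0+s-1
   (0-based indices) *)
Definition cminor (R : comNzRingType) (m n : nat) (A : 'M[R]_(m, n)) (r0 c0 s : nat) : R :=
  \det (\matrix_(a < s, b < s) entry A (r0 + a) (c0 + b)).

Definition is_minor (R : comNzRingType) (m n t : nat) (A : 'M[R]_(m, n)) (g : R) : Prop :=
  exists (f : 'I_t -> 'I_m) (h : 'I_t -> 'I_n),
    (forall a b : 'I_t, (a < b)%N -> (f a < f b)%N) /\
    (forall a b : 'I_t, (a < b)%N -> (h a < h b)%N) /\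
    g = \det (\matrix_(a, b) A (f a) (h b)).

Definition in_ideal (R : comNzRingType) (P : R -> Prop) (f : R) : Prop :=
  exists l : seq (R * R), (forall q, q \in l -> P q.2) /\
                          f = \sum_(q <- l) q.1 * q.2.

Definition It (R : comNzRingType) (m n : nat) (t : nat) (A : 'M[R]_(m, n)) : R -> Prop :=
  in_ideal (is_minor t A).

Definition compatible (R : comNzRingType) (phi : R -> R) (I : R -> Prop) : Prop :=
  forall f, I f -> I (phi f).

Definition firstRows (R : Type) (m n : nat) (r : nat) (A : 'M[R]_(m, n)) : 'M[R]_(minn r m, n) :=
  \matrix_(i, j) A (widen_ord (geq_minr r m) i) j.

(* The Frobenius trace Phi : F_* S -> S, written as a map S -> S.
   rt is the p-th root function of the perfect field k.
   Phi(c x^a) = rt(c) x^((a-(p-1))/p) if all a_i = p-1 mod p, else 0. *)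
Definition frob_trace (k : fieldType) (N p : nat) (rt : k -> k) (f : {mpoly k[N]}) : {mpoly k[N]} :=
  \sum_(a <- msupp f | [forall i : 'I_N, (a i %% p == p.-1)%N])
     rt (f@_a) *: 'X_[ [multinom (a i %/ p)%N | i < N] ].

Section Delta.
Variables (k : fieldType) (m n : nat).
Local Notation X := (xmat k m n).
Local Notation mu := (minn m n).
Definition alpha (i : nat) := cminor X (m - i) 0 i.
Definition beta (i : nat) := cminor X 0 (n - i) i.
(* delta_j, j = 1..|n-m|+1 : mu-minor on consecutive columns (m <= n)
   resp. consecutive rows (m >= n) starting at position j *)
Definition delta (j : nat) :=
  if (m <= n)%N then cminor X 0 j.-1 mu else cminor X j.-1 0 mu.
Definition Delta : {mpoly k[m * n]} :=
  (\prod_(1 <= i < mu) alpha i) *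
  (\prod_(1 <= j < ((n - m) + (m - n)).+2) delta j) *
  (\prod_(1 <= i < mu) beta i).
End Delta.

Definition phi_map (k : fieldType) (m n p : nat) (rt : k -> k) (f : {mpoly k[m * n]}) :=
  frob_trace p rt (Delta k m n ^+ p.-1 * f).
Arguments phi_map k m n p rt f : clear implicits.
Arguments Delta k m n : clear implicits.

(* Main.v *)
(** Compatibility of [I = I_{r+1}] of the first [M] rows of [x]: the pairs needed are
    [(M, r) = (m, t-1)] and [(t-1, t-2)].  Let [d] be the top left [r]-minor.  Away from
    [d] the ideal [I] is generated by the [h = (M-r)(n-r)] minors bordering [d], and an
    [s]-minor with [e] of its rows among the first [M] lies in [I^(e-r)] there.  Adding
    up over the factors of [Delta] gives [Delta] in [I^h], so by the pigeonhole principle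
    [d^N Delta^(p-1) I] is contained in the ideal of [p]-th powers of the bordering
    minors, that is [d^N' phi(I)] is contained in [I].  It remains to cancel [d] modulo
    [I], which follows from the description of [I] as the ideal of all polynomials that
    vanish on products [C U] with [U] having [r] rows.  That description is proved as in
    Hochster and Eagon, by adding the entries of the matrix to the ideal one by one.

    For [phi(1) = 1], give [x_(i,j)] the weight [(i+1)(j+1)] (indices from [0]).  By the
    rearrangement inequality the diagonal is the only term of maximal weight of a minor on
    consecutive rows and columns, and each variable lies on exactly one of the diagonals
    of the factors of [Delta].  Hence the product of all variables has coefficient [1] in
    [Delta], and every other monomial of [Delta] has smaller weight. *)
Require Import Defs.
From HB Require Import structures.
From mathcomp Require Import all_boot all_order all_algebra.
From mathcomp Require Import perm mpoly zify ring.
Set Implicit Arguments. Unset Strict Implicit. Unset Printing Implicit Defensive.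
Import GRing.Theory.
Local Open Scope ring_scope.

(** * Ideals and minors *)

Section InIdeal.
Variables (R : comNzRingType) (P : R -> Prop).

Lemma in_ideal0 : in_ideal P 0.
Proof. by exists [::]; split => //; rewrite big_nil. Qed.

Lemma in_idealD f g : in_ideal P f -> in_ideal P g -> in_ideal P (f + g).
Proof.
case=> l1 [P1 ->] [l2 [P2 ->]]; exists (l1 ++ l2); split; last by rewrite big_cat.
by move=> q; rewrite mem_cat => /orP[/P1|/P2].
Qed.

Lemma in_idealMl a f : in_ideal P f -> in_ideal P (a * f).
Proof.
case=> l [Pl ->]; exists [seq (a * q.1, q.2) | q <- l]; split.
  by move=> _ /mapP[q /Pl Pq ->].
by rewrite big_map mulr_sumr; apply: eq_bigr => q _; rewrite mulrA.
Qed.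

Lemma in_ideal_gen g : P g -> in_ideal P g.
Proof.
move=> Pg; exists [:: (1, g)]; split; last by rewrite big_seq1 mul1r.
by move=> q; rewrite inE => /eqP->.
Qed.

Lemma in_ideal_ind (Q : R -> Prop) :
  Q 0 -> (forall f g, Q f -> Q g -> Q (f + g)) ->
  (forall a g, P g -> Q (a * g)) -> forall f, in_ideal P f -> Q f.
Proof.
move=> Q0 QD QM f [l [Pl ->]]; rewrite big_seq.
by apply: (big_ind Q) => // q /Pl; apply: QM.
Qed.
End InIdeal.

Lemma in_ideal_sub (R : comNzRingType) (P Q : R -> Prop) :
  (forall g, P g -> in_ideal Q g) -> forall f, in_ideal P f -> in_ideal Q f.
Proof.
move=> PQ; apply: in_ideal_ind; first exact: in_ideal0.
  exact: in_idealD.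
by move=> a g /PQ; apply: in_idealMl.
Qed.

Section Minors.
Variable R : comNzRingType.
Implicit Types (F : nat -> nat -> R) (f h : nat -> nat).

(** Index functions on [nat], with no order or injectivity, keep bordering and Laplace expansion
    free of dependent types; [in_ideal_minor] later returns to increasing indices. *)
Definition nminor F s f h : R := \det (\matrix_(a < s, b < s) F (f a) (h b)).

Lemma nminor_tr F s f h : nminor F s f h = nminor (fun i j => F j i) s h f.
Proof. by rewrite /nminor -det_tr; congr (\det _); apply/matrixP=> a b; rewrite !mxE. Qed.

Lemma nminor_row_eq F s f h a1 a2 :
  (a1 < a2 < s)%N -> f a1 = f a2 -> nminor F s f h = 0.
Proof.
case/andP=> lt12 lt2 e; have lt1 := ltn_trans lt12 lt2.
apply: (determinant_alternate (i1 := Ordinal lt1) (i2 := Ordinal lt2)).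
  by rewrite -val_eqE /= ltn_eqF.
by move=> b; rewrite !mxE /= e.
Qed.

Lemma nminor_col_eq F s f h a1 a2 :
  (a1 < a2 < s)%N -> h a1 = h a2 -> nminor F s f h = 0.
Proof. by rewrite nminor_tr; apply: nminor_row_eq. Qed.

Lemma nminor1 F f h : nminor F 1 f h = F (f 0%N) (h 0%N).
Proof. by rewrite /nminor det_mx11 mxE. Qed.

(* A factorization through fewer than [s] dimensions, padded to square factors. *)
Lemma det_factor_lt s L (A B : nat -> nat -> R) : (L < s)%N ->
  \det (\matrix_(a < s, b < s) \sum_(l < L) A a l * B l b) = 0.
Proof.
move=> ltL.
have -> : \matrix_(a < s, b < s) (\sum_(l < L) A a l * B l b) =
   (\matrix_(a < s, l < s) (if (l < L)%N then A a l else 0))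
     *m (\matrix_(l < s, b < s) B l b).
  apply/matrixP=> a b; rewrite !mxE.
  rewrite (big_ord_widen s (fun l => A a l * B l b) (ltnW ltL)) big_mkcond /=.
  by apply: eq_bigr => l _; rewrite !mxE; case: ifP => //; rewrite mul0r.
rewrite det_mulmx (expand_det_col _ (Ordinal ltL)) big1 ?mul0r // => i _.
by rewrite mxE /= ltnn mul0r.
Qed.

Definition scons (x : nat) (f : nat -> nat) (a : nat) := if a is a'.+1 then f a' else x.

Lemma nminor_scons F s i j f h :
  nminor F s.+1 (scons i f) (scons j h) =
  F i j * nminor F s f h +
  \sum_(b < s) F i (h b) *
     ((-1) ^+ b.+1 * nminor F s f (fun x => scons j h (bump b.+1 x))).
Proof.
rewrite {1}/nminor (expand_det_row _ ord0) big_ord_recl.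
rewrite mxE /= /cofactor /= addn0 expr0 mul1r; congr (_ * \det _ + _).
  by apply/matrixP => a b; rewrite !mxE /=.
apply: eq_bigr => b _; rewrite !mxE /= add0n; congr (_ * (_ * \det _)).
by apply/matrixP => a d; rewrite !mxE /=.
Qed.

End Minors.

(** * Matrices factored through [r] dimensions *)

Lemma msizeM_pred (R : fieldType) (n : nat) (p q : {mpoly R[n]}) :
  (msize (p * q) <= (msize p + msize q).-1)%N.
Proof.
have [->|nzp] := eqVneq p 0; first by rewrite mul0r msize0.
have [->|nzq] := eqVneq q 0; first by rewrite mulr0 msize0.
by rewrite msizeM.
Qed.

Section Evaluation.
Variables (k : fieldType) (m n : nat).
Local Notation S := {mpoly k[m * n]}.

Definition xx (i j : nat) : S := entry (xmat k m n) i j.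

Lemma xxE i j (lti : (i < m)%N) (ltj : (j < n)%N) :
  xx i j = 'X_(mxvec_index (Ordinal lti) (Ordinal ltj)).
Proof. by rewrite /xx /entry !insubT mxE. Qed.

Lemma xx_ord (i : 'I_m) (j : 'I_n) : xx i j = 'X_(mxvec_index i j).
Proof. by case: i j => i lti [j ltj]; rewrite xxE. Qed.

Lemma msize_xx i j : (msize (xx i j) <= 2)%N.
Proof.
rewrite /xx /entry; case: insubP => [u _ _|_]; last by rewrite msize0.
case: insubP => [v _ _|_]; last by rewrite msize0.
by rewrite mxE msizeX mdeg1.
Qed.

Lemma msize_prod_le (I : Type) (s : seq I) (F : I -> S) :
  (forall i, msize (F i) <= 2)%N -> (msize (\prod_(i <- s) F i) <= (size s).+1)%N.
Proof.
move=> leF; elim: s => [|i s IH]; first by rewrite big_nil msize1.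
rewrite big_cons; apply: leq_trans (msizeM_pred _ _) _.
by have := leF i; rewrite [size (_ :: _)]/=; lia.
Qed.

Lemma msize_nminor s f h : (msize (nminor xx s f h) <= s.+1)%N.
Proof.
rewrite /nminor /determinant; apply: leq_trans (msize_sum _ _ _) _.
apply/bigmax_leqP_seq => /= t _ _.
have -> : (-1) ^+ t * (\prod_i (\matrix_(a, b) xx (f a) (h b)) i (t i)) =
     ((-1) ^+ t : k) *: (\prod_(i < s) xx (f i) (h (t i))) :> S.
  rewrite -mul_mpolyC rmorphXn rmorphN rmorph1; congr (_ * _).
  by apply: eq_bigr => i _; rewrite mxE.
apply: leq_trans (msizeZ_le _ _) _.
have := @msize_prod_le _ (index_enum 'I_s) (fun i => xx (f i) (h (t i)))
  (fun i => msize_xx _ _).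
by rewrite /index_enum -enumT size_enum_ord.
Qed.

Section Eval.
Variables (A : comNzRingType) (iota : {rmorphism k -> A}).

Definition evalat (V : nat -> nat -> A) : S -> A :=
  mmap iota (fun q => mxvec (\matrix_(i < m, j < n) V i j) 0 q).

HB.instance Definition _ V := GRing.RMorphism.copy (evalat V)
  (mmap iota (fun q => mxvec (\matrix_(i < m, j < n) V i j) 0 q)).

Lemma evalatD V f g : evalat V (f + g) = evalat V f + evalat V g.
Proof. exact: rmorphD. Qed.

Lemma evalatM V f g : evalat V (f * g) = evalat V f * evalat V g.
Proof. exact: rmorphM. Qed.

Lemma evalat_xx V i j : (i < m)%N -> (j < n)%N -> evalat V (xx i j) = V i j.
Proof. by move=> lti ltj; rewrite xxE /evalat mmapX mmap1U mxvecE mxE. Qed.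

Lemma evalat_nminor V s f h : (forall a, a < s -> f a < m)%N ->
  (forall a, a < s -> h a < n)%N -> evalat V (nminor xx s f h) = nminor V s f h.
Proof.
move=> ltf lth; rewrite /nminor -det_map_mx; congr (\det _).
by apply/matrixP => a b; rewrite !mxE; apply: evalat_xx; rewrite ?ltf ?lth.
Qed.

Lemma eq_evalat V1 V2 f :
  (forall i j, i < m -> j < n -> V1 i j = V2 i j)%N -> evalat V1 f = evalat V2 f.
Proof.
move=> eV; rewrite /evalat.
suff -> : \matrix_(i < m, j < n) V1 i j = \matrix_(i < m, j < n) V2 i j by [].
by apply/matrixP => i j; rewrite !mxE eV.
Qed.
End Eval.

Lemma rmorph_evalat (A B : comNzRingType) (iota : {rmorphism k -> A})
  (g : {rmorphism A -> B}) V f :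
  g (evalat iota V f) = evalat (g \o iota) (fun i j => g (V i j)) f.
Proof.
rewrite /evalat /mmap rmorph_sum; apply: eq_bigr => u _.
rewrite rmorphM rmorph_prod; congr (_ * _); apply: eq_bigr => q _.
by rewrite rmorphXn; congr (_ ^+ _); case/mxvec_indexP: q => i j; rewrite !mxvecE !mxE.
Qed.

Lemma eq_evalat_rmorph (A : comNzRingType) (i1 i2 : {rmorphism k -> A}) V f :
  i1 =1 i2 -> evalat i1 V f = evalat i2 V f.
Proof. by move=> e; rewrite /evalat /mmap; apply: eq_bigr => u _; rewrite e. Qed.

End Evaluation.
Arguments xx {k m n}.

(** * Staircase-shaped factorizations and the ideals vanishing on them *)

Section DeterminantalIdeal.
Variables (k : fieldType) (m n M r : nat).
Local Notation S := {mpoly k[m * n]}.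
Implicit Types (b : nat -> nat).

(** Only the first [M] rows have to factor; the other rows stay free, since the minors in question
    do not involve their variables. *)
Definition factored (A : comNzRingType) (C U W : nat -> nat -> A) i j : A :=
  if (i < M)%N then \sum_(l < r) C i l * U l j else W i j.

(** The zeros of [U] form a staircase with steps at the columns [b l]. Together with the zeros of
    [C] they make the rows before [r0], and the first [c] entries of row [r0], vanish in the
    product. *)
Definition shaped (A : comNzRingType) b r0 c (C U : nat -> nat -> A) :=
  [/\ forall i l, (i < r0)%N -> C i l = 0,
      forall l, (l < r)%N -> (b l < c)%N -> C r0 l = 0
    & forall l j, (l < r)%N -> (j < b l)%N -> U l j = 0].

(* Quantifying over all domains replaces a generic point: specializing is free, and
   generic parameters are available by passing to a polynomial ring. *)
Definition vanishing b r0 c (f : S) : Prop :=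
  forall (A : idomainType) (iota : {rmorphism k -> A}) (C U W : nat -> nat -> A),
    shaped b r0 c C U -> evalat iota (factored C U W) f = 0.

Lemma vanishingW b1 r1 c1 b2 r2 c2 f :
  (forall (A : idomainType) (C U : nat -> nat -> A),
     shaped b2 r2 c2 C U -> shaped b1 r1 c1 C U) ->
  vanishing b1 r1 c1 f -> vanishing b2 r2 c2 f.
Proof. by move=> sub vf A iota C U W /sub; apply: vf. Qed.

Definition deform (A : idomainType) (E : nat -> nat -> bool) (C : nat -> nat -> A)
  i j : {poly A} := (C i j)%:P + (E i j)%:R * 'X.

(* A nonzero value along the line [(C + T EC) (U + T EU)] over [A[T]] lets one
   cancel [e] there, and then set [T = 0]. *)
Lemma vanishing_cancel b r0 c (EC EU : nat -> nat -> bool) e f :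
  (forall A : comNzRingType, shaped b r0 c (fun i l => (EC i l)%:R : A)
                                           (fun l j => (EU l j)%:R)) ->
  (forall (A : idomainType) (iota : {rmorphism k -> A}) (C U W : nat -> nat -> A),
     shaped b r0 c C U ->
     evalat (polyC \o iota) (factored (deform EC C) (deform EU U) (fun i j => (W i j)%:P)) e
       != 0) ->
  vanishing b r0 c (e * f) -> vanishing b r0 c f.
Proof.
move=> shE ne0 vef A iota C U W shCU.
(* The directions [EC] and [EU] have the prescribed zeros themselves, so the whole line stays inside
   the locus. *)
have shD : shaped b r0 c (deform EC C) (deform EU U).
  case: (shE A) shCU => E1 E2 E3 [C1 C2 C3]; rewrite /deform.
  have nz (t : bool) : t%:R = 0 :> A -> t = false.
    by case: t => // /eqP; rewrite oner_eq0.
  split=> [i l lt|l lt ltc|l j lt ltj].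
  - by rewrite C1 // (nz _ (E1 i l lt)) mul0r addr0.
  - by rewrite C2 // (nz _ (E2 l lt ltc)) mul0r addr0.
  - by rewrite C3 // (nz _ (E3 l j lt ltj)) mul0r addr0.
have /eqP := vef _ (polyC \o iota : {rmorphism k -> {poly A}}) _ _
  (fun i j => (W i j)%:P) shD.
rewrite rmorphM mulf_eq0 (negPf (ne0 _ _ _ _ _ shCU)) /= => /eqP v0.
have := congr1 (horner_eval 0) v0; rewrite rmorph_evalat rmorph0.
rewrite (@eq_evalat_rmorph _ _ _ _ _ iota); last first.
  by move=> x; apply: hornerC.
move=> <-; apply: eq_evalat => i j _ _; rewrite /factored.
have Dh E (B : nat -> nat -> A) a d : horner_eval 0 (deform E B a d) = B a d.
  by rewrite /horner_eval /deform hornerD hornerC hornerM hornerX mulr0 addr0.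
case: ifP => _; last by apply/esym/hornerC.
by rewrite rmorph_sum; apply: eq_bigr => l _; rewrite rmorphM /= !Dh.
Qed.

(* [b] lists the columns where the rank may jump: the first [b l] columns have rank at
   most [l].  In addition the rows before [r0] and the first [c] entries of row [r0]
   vanish.  The first index is the degree of the generator. *)
Inductive gens b r0 c : nat -> S -> Prop :=
| gen_row i j of (i < r0)%N & (i < M)%N & (j < n)%N : gens b r0 c 1 (xx i j)
| gen_cell j of (j < c)%N & (r0 < M)%N & (j < n)%N : gens b r0 c 1 (xx r0 j)
| gen_minor l f h of (l <= r)%N & (forall a, a <= l -> f a < M)%N
    & (forall a, a <= l -> h a < b l)%N : gens b r0 c l.+1 (nminor xx l.+1 f h).

(* Combinations of the generators whose terms have degree less than [D]. *)
Inductive bideal (G : nat -> S -> Prop) (D : nat) : S -> Prop :=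
| bideal0 : bideal G D 0
| bideal_cons a g f s of G s g & (msize a + s <= D)%N & bideal G D f :
    bideal G D (a * g + f).

Lemma bidealD G D f1 f2 : bideal G D f1 -> bideal G D f2 -> bideal G D (f1 + f2).
Proof.
move=> I1 I2; elim: I1 => [|a g f s Gg sz _ IH]; first by rewrite add0r.
by rewrite -addrA; apply: bideal_cons Gg sz IH.
Qed.

Lemma bideal1 G D a g s : G s g -> (msize a + s <= D)%N -> bideal G D (a * g).
Proof. by move=> Gg sz; rewrite -[_ * _]addr0; apply: bideal_cons Gg sz (bideal0 _ _). Qed.

Lemma bideal_sum G D (I : Type) (s : seq I) (P : pred I) F :
  (forall i, P i -> bideal G D (F i)) -> bideal G D (\sum_(i <- s | P i) F i).
Proof.
by move=> bF; apply: (big_ind (bideal G D)) => //; [apply: bideal0 | apply: bidealD].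
Qed.

Lemma bideal_sub G1 G2 D f : (forall s g, G1 s g -> G2 s g) ->
  bideal G1 D f -> bideal G2 D f.
Proof.
move=> sub; elim=> [|a g f' s Gg sz _ IH]; first exact: bideal0.
exact: bideal_cons (sub _ _ Gg) sz IH.
Qed.

Lemma msizeM_xx (a : S) i j : (msize (a * xx i j) <= (msize a).+1)%N.
Proof.
apply: leq_trans (msizeM_pred _ _) _.
by have := @msize_xx k m n i j; lia.
Qed.

Lemma bideal_mulxx G1 G2 D f i j :
  (forall a g s, G1 s g -> msize a + s <= D -> bideal G2 D.+1 (a * (xx i j * g)))%N ->
  bideal G1 D f -> bideal G2 D.+1 (xx i j * f).
Proof.
move=> step; elim=> [|a g f' s Gg sz _ IH]; first by rewrite mulr0; apply: bideal0.
rewrite mulrDr; apply: bidealD IH.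
by rewrite mulrCA; apply: step Gg sz.
Qed.

Lemma bideal_mulxx_gen G (D : nat) a g s i j : G s g -> (msize a + s <= D)%N ->
  bideal G D.+1 (a * (xx i j * g)).
Proof.
move=> Gg sz; rewrite mulrA; apply: bideal1 Gg _.
apply: leq_trans (leq_add (msizeM_xx a i j) (leqnn s)) _.
by rewrite addSn ltnS.
Qed.

(** Passing from [c] to [c.+1] adds at most the generator [xx r0 c], of degree 1; its coefficients
    are collected in [h], whence the drop in size. *)
Lemma bideal_split b r0 c D f : bideal (gens b r0 c.+1) D f ->
  exists g h, [/\ bideal (gens b r0 c) D g, (msize h <= D.-1)%N & f = g + xx r0 c * h].
Proof.
elim=> [|a g f' s Gg sz _ [g' [h' [Ig' szh ->]]]].
  by exists 0, 0; split; rewrite ?msize0 ?mulr0 ?addr0 //; apply: bideal0.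
have old : gens b r0 c s g -> exists g'' h,
    [/\ bideal (gens b r0 c) D g'', (msize h <= D.-1)%N
      & a * g + (g' + xx r0 c * h') = g'' + xx r0 c * h].
  move=> Gg'; exists (a * g + g'), h'; split; rewrite ?addrA //.
  exact: bideal_cons Gg' sz Ig'.
case: Gg sz old.
- by move=> i j ltr ltM ltn _; apply; apply: gen_row.
- move=> j; rewrite ltnS leq_eqVlt => /orP[/eqP -> ltM ltn sz _|ltj ltM ltn _]; last first.
    by apply; apply: gen_cell.
  exists g', (a + h'); split => //; last by ring.
  by apply: leq_trans (msizeD_le _ _) _; rewrite geq_max; apply/andP; split; lia.
- by move=> l u h ler ltu lth _; apply; apply: gen_minor.
Qed.

(** The condition at [r] lets the generators of size [r.+1] use all columns. *)
Definition pivots b := b r = n /\ forall l, (l < r)%N -> (b l < b l.+1)%N.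

Lemma pivots_mono b l1 l2 : pivots b -> (l1 < l2 <= r)%N -> (b l1 < b l2)%N.
Proof.
case=> _ bS /andP[]; elim: l2 => // l2 IH; rewrite ltnS leq_eqVlt => /orP[/eqP->|lt12] le2.
  exact: bS.
exact: ltn_trans (IH lt12 (ltnW le2)) (bS _ le2).
Qed.

Lemma pivots_le b l1 l2 : pivots b -> (l1 <= l2 <= r)%N -> (b l1 <= b l2)%N.
Proof.
move=> pb /andP[]; rewrite leq_eqVlt => /orP[/eqP->|lt] le //.
by apply/ltnW/pivots_mono; rewrite ?lt.
Qed.

Lemma factored_cell0 (A : comNzRingType) b r0 c (C U W : nat -> nat -> A) j :
  (r0 < M)%N -> (j < c)%N -> shaped b r0 c C U -> factored C U W r0 j = 0.
Proof.
move=> ltM ltj [_ C2 U0]; rewrite /factored ltM big1 // => l _.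
case: (ltnP (b l) c) => [lt|le]; first by rewrite C2 ?mul0r.
by rewrite U0 ?mulr0 // (leq_trans ltj le).
Qed.

Hypothesis leMm : (M <= m)%N.

(** On the first [b l] columns only the rows of [U] before [l] can be nonzero, so an [l.+1]-minor
    there factors through [l] dimensions. *)
Lemma gens_vanishing b r0 c s g : pivots b -> gens b r0 c s g -> vanishing b r0 c g.
Proof.
move=> pb Gg A iota C U W sh; case: Gg.
- move=> i j ltr ltM ltn; rewrite evalat_xx ?(leq_trans ltM) // /factored ltM big1 // => l _.
  by case: sh => C1 _ _; rewrite C1 ?mul0r.
- move=> j ltj ltM ltn; rewrite evalat_xx ?(leq_trans ltM) //.
  exact: factored_cell0 sh.
- move=> l f h ler ltf lth.
  have lebn : (b l <= n)%N by case: (pb) => <- _; apply: pivots_le; rewrite // ler leqnn.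
  rewrite evalat_nminor; first last.
  + by move=> a; rewrite ltnS => /lth lt; apply: leq_trans lebn.
  + by move=> a; rewrite ltnS => /ltf lt; apply: leq_trans leMm.
  rewrite -(@det_factor_lt _ l.+1 l (fun a => C (f a)) (fun t a => U t (h a))) //.
  congr (\det _); apply/matrixP => a d; rewrite !mxE /factored ltf ?(ltn_ord a) -1?ltnS //.
  rewrite (big_ord_widen r (fun t => C (f a) t * U t (h d)) ler) [RHS]big_mkcond /=.
  apply: eq_bigr => t _; case: ltnP => // let_; case: sh => _ _ U0.
  have lthd : (h d < b l)%N by apply: lth; rewrite -ltnS.
  have le_b : (b l <= b t)%N by apply: pivots_le pb _; rewrite let_ ltnW.
  by rewrite U0 ?mulr0 // (leq_trans lthd).
Qed.

Lemma vanishingD b r0 c f g :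
  vanishing b r0 c f -> vanishing b r0 c g -> vanishing b r0 c (f + g).
Proof. by move=> vf vg A iota C U W sh; rewrite evalatD vf ?vg ?addr0. Qed.

Lemma vanishingMl b r0 c a f : vanishing b r0 c f -> vanishing b r0 c (a * f).
Proof. by move=> vf A iota C U W sh; rewrite evalatM vf ?mulr0. Qed.

Lemma bideal_vanishing G b r0 c D f :
  (forall s g, G s g -> vanishing b r0 c g) -> bideal G D f -> vanishing b r0 c f.
Proof.
move=> vG; elim=> [|a g f' s /vG vg _ _ IH]; first by move=> A iota C U W _; rewrite rmorph0.
exact: vanishingD (vanishingMl _ vg) IH.
Qed.

(* At a pivot column the entry [(r0, c)] of [C U] is the single product
   [C r0 l * U l c], so it is not a zero divisor modulo the vanishing ideal. *)
Lemma vanishing_cancel_pivot b r0 l f : pivots b -> (l < r)%N -> (r0 < M)%N ->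
  vanishing b r0 (b l) (xx r0 (b l) * f) -> vanishing b r0 (b l) f.
Proof.
move=> pb ltl ltM.
have ltbn : (b l < n)%N by case: (pb) => <- _; apply: pivots_mono; rewrite // ltl leqnn.
(* Adding [T] to [C r0 l] and to [U l (b l)] respects the shape and turns the pivot entry into a
   product of two monic linear polynomials in [T]. *)
apply: (@vanishing_cancel _ _ _ (fun i t => (i == r0) && (t == l))
                                (fun t j => (t == l) && (j == b l))).
  move=> A; split.
  - by move=> i t lti; rewrite ltn_eqF.
  - by move=> t _ ltt; case: (t =P l) => [e|]; rewrite ?andbF //; move: ltt; rewrite e ltnn.
  - by move=> t j _; case: eqP => [->|//] ltj; rewrite ltn_eqF.
move=> A iota C U W [_ C2 U0]; rewrite evalat_xx ?(leq_trans ltM) // /factored ltM.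
rewrite (bigD1 (Ordinal ltl)) //= big1 ?addr0.
  rewrite /deform !eqxx /= !mul1r mulf_eq0 negb_or.
  by rewrite ![_%:P + 'X]addrC -!size_poly_eq0 !size_XaddC.
move=> t net; have ltt := ltn_ord t.
have net' : (nat_of_ord t == l) = false by rewrite -(negPf net) -val_eqE.
rewrite /deform net' andbF /= !mul0r !addr0.
(* For [t < l] the entry [C r0 t] is zero because [b t < b l]; for [t > l] the entry [U t (b l)] is
   zero because [b l < b t]. *)
case: (ltngtP t l) => [lt|lt|e]; last by rewrite e eqxx in net'.
  by rewrite C2 ?mul0r //; apply: pivots_mono; rewrite // lt ltnW.
by rewrite [U _ _]U0 ?mulr0 //; apply: pivots_mono; rewrite // lt ltnW.
Qed.

End DeterminantalIdeal.

(** * Generators of the vanishing ideals, by induction over the cells *)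

Section HochsterEagon.
Variables (k : fieldType) (m n M r : nat).
Local Notation S := {mpoly k[m * n]}.
Implicit Types (b : nat -> nat) (f g : S).
Local Notation vanishing := (@vanishing k m n M r).
Local Notation gens := (@gens k m n M r).
Local Notation pivots := (@pivots n r).
Definition upd b l c t := if t == l then c else b t : nat.

Definition low_free (u : 'X_{1..m * n}) :=
  [forall i : 'I_m, forall j : 'I_n, (i < M)%N ==> (u (mxvec_index i j) == 0)%N].

Lemma evalat_low0 u :
  evalat (mpolyC (m * n) (R := k)) (factored M r (fun _ _ => 0) (fun _ _ => 0) xx)
    'X_[u] = if low_free u then 'X_[u] else 0.
Proof.
rewrite /evalat mmapX /mmap1; case: ifPn => [|].
  move=> /forallP lf; rewrite mpolyXE_id; apply: eq_bigr => q _.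
  case/mxvec_indexP: q => i j; rewrite mxvecE mxE /factored xx_ord.
  have /forallP/(_ j) := lf i; case: ifP => //= _ /eqP ->.
  by rewrite !expr0.
rewrite negb_forall => /existsP[i]; rewrite negb_forall => /existsP[j].
rewrite negb_imply => /andP[ltM ne0].
rewrite (bigD1 (mxvec_index i j)) //= mxvecE mxE /factored ltM.
by rewrite big1 => [|l _]; rewrite ?mul0r // expr0n (negPf ne0) mul0r.
Qed.

(** Base case, with all [M] rows equal to zero: evaluating at [C = U = 0] and keeping the variables
    of the other rows shows that each monomial of [f] contains a variable of the first [M] rows. *)
Lemma vanishing_bideal_rows b c D f : (msize f <= D)%N -> vanishing b M c f ->
  bideal (gens b M c) D f.
Proof.
move=> szf vf; rewrite [f]mpolyE big_seq; apply: bideal_sum => u uf.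
have : ~~ low_free u.
  apply/negP => lfu; move: uf; rewrite mcoeff_msupp => /eqP; apply.
  have sh0 : shaped r b M c (fun _ _ => 0 : S) (fun _ _ => 0 : S) by split.
  have := congr1 (mcoeff u) (vf _ (mpolyC (m * n) (R := k)) _ _ xx sh0).
  rewrite mcoeff0 => <-; rewrite {1}[f]mpolyE /evalat /mmap !raddf_sum /=.
  apply: eq_bigr => v _; rewrite mcoeffZ mcoeffCM; congr (_ * _).
  have := evalat_low0 v; rewrite /evalat mmapX mcoeffX => ->.
  case: ifPn => [_|nlf]; first by rewrite mcoeffX.
  by rewrite mcoeff0; case: eqP => // e; rewrite e lfu in nlf.
rewrite negb_forall => /existsP[i]; rewrite negb_forall => /existsP[j].
rewrite negb_imply => /andP[ltM ne0].
have le1 : (U_(mxvec_index i j) <= u)%MM by rewrite lep1mP.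
rewrite -[u in 'X_[u]](submK le1) mpolyXD scalerAl -xx_ord.
apply: (bideal1 (s := 1)); first by apply: gen_row.
apply: leq_trans (leq_add (msizeZ_le _ _) (leqnn 1)) _; rewrite msizeX.
have : mdeg u = (mdeg (u - U_(mxvec_index i j))).+1.
  by rewrite -{1}(submK le1) mdegD mdeg1 addn1.
by move: (leq_trans (msize_mdeg_lt uf) szf); lia.
Qed.

(** Drives the induction: at a pivot the next entry can be cancelled, before the first pivot it
    already is a generator, and between two pivots a second component appears. *)
Lemma pivots_case b c : pivots b -> (c < n)%N ->
  [\/ exists2 l, (l < r)%N & b l = c, (c < b 0)%N
    | exists2 l, (l < r)%N & (b l < c < b l.+1)%N].
Proof.
move=> [brn bS] ltcn.
have ex : exists l, (c <= b l)%N by exists r; rewrite brn ltnW.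
case: (ex_minnP ex) => l; rewrite leq_eqVlt => /orP[/eqP e|lt] min.
  constructor 1; exists l => //.
  have := min r; rewrite brn (ltnW ltcn) => /(_ isT).
  by rewrite leq_eqVlt => /orP[/eqP e'|//]; rewrite e' brn in e; lia.
case: l lt min => [|l] lt min; first by constructor 2.
constructor 3; exists l; first by have := min r; rewrite brn (ltnW ltcn) => /(_ isT).
by rewrite lt andbT ltnNge; apply/negP => /min; rewrite ltnn.
Qed.

Lemma pivots_upd b l c : pivots b -> (l < r)%N -> (b l < c < b l.+1)%N ->
  pivots (upd b l c).
Proof.
move=> pb ltl /andP[ltc clt]; rewrite /upd; split.
  by rewrite gtn_eqF //; case: pb.
move=> t ltt; case: (t =P l) => [->|/eqP ne]; first by rewrite gtn_eqF.
case: (t.+1 =P l) => [e|_]; last by case: pb => _; apply.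
by apply: ltn_trans ltc; rewrite -e; case: pb => _; apply.
Qed.

Lemma shaped_upd (A : idomainType) b r0 c l (C U : nat -> nat -> A) :
  (b l <= c)%N -> shaped r (upd b l c.+1) r0 c.+1 C U -> shaped r (upd b l c) r0 c C U.
Proof.
move=> lec [C1 C2 U0]; split=> //.
  move=> t ltt; rewrite /upd; case: eqP => [_|ne]; first by rewrite ltnn.
  by move=> lt; apply: C2; rewrite // /upd; case: eqP => // _; apply: ltnW.
move=> t j ltt ltj; apply: U0 => //; move: ltj; rewrite /upd.
by case: eqP => // _ /ltnW.
Qed.

Lemma shapedS (A : idomainType) b r0 c (C U : nat -> nat -> A) :
  shaped r b r0 c.+1 C U -> shaped r b r0 c C U.
Proof. by case=> C1 C2 U0; split=> // l ltl lt; apply: C2 => //; apply: ltnW. Qed.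

Hypothesis leMm : (M <= m)%N.

(** Write [f = g + xx r0 c * h] over the ideal with one more cell. Cancelling the pivot entry shows
    that [h] vanishes on the same locus, and its smaller size permits induction on [D]. *)
Lemma vanishing_bideal_pivot b r0 l (c := b l) :
  pivots b -> (l < r)%N -> (r0 < M)%N ->
  (forall D f, (msize f <= D)%N -> vanishing b r0 c.+1 f ->
     (forall t, (t < r)%N -> (b t < c.+1 < b t.+1)%N ->
        vanishing (upd b t c.+1) r0 c.+1 f) ->
     bideal (gens b r0 c.+1) D f) ->
  forall D f, (msize f <= D)%N -> vanishing b r0 c f -> bideal (gens b r0 c) D f.
Proof.
move=> pb ltl ltM IH; elim=> [|D IHD] f szf vf.
  move: szf; rewrite leqn0 msize_poly_eq0 => /eqP ->; exact: bideal0.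
have [] := bideal_split (IH _ _ szf _ _).
- by apply: vanishingW vf => A C U; apply: shapedS.
- move=> t ltt /andP[lt1 lt2].
  have -> : t = l.
    case: (ltngtP t l) => // lt.
      suff : (b t.+1 <= b l)%N by rewrite -/c; lia.
      by apply: pivots_le pb _; rewrite lt ltnW.
    suff : (b l < b t)%N by rewrite -/c; lia.
    by apply: pivots_mono pb _; rewrite lt ltnW.
  (* As [c] is [b l], [upd b l c] agrees with [b], so [shaped_upd] puts the second component at
     [c.+1] inside the locus at [c]. *)
  have shE (A : idomainType) (C U : nat -> nat -> A) :
    shaped r (upd b l c) r0 c C U -> shaped r b r0 c C U.
    have e t' : upd b l c t' = b t' by rewrite /upd; case: eqP => // ->.
    by case=> C1 C2 U0; split=> // t'; [move=> ? ?; apply: C2; rewrite ?e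
                                       |move=> j ? ?; apply: U0; rewrite ?e].
  by apply: vanishingW vf => A C U /(shaped_upd (leqnn (b l))); apply: shE.
move=> g [h [Ig szh ef]]; rewrite ef; apply: bidealD => //.
apply: bideal_mulxx => [a g' s Gg' sz|]; last apply: IHD => //.
  exact: bideal_mulxx_gen Gg' sz.
apply: (vanishing_cancel_pivot leMm pb ltl ltM).
have -> : xx r0 (b l) * h = f + (-1) * g by rewrite ef -/c; ring.
apply: vanishingD => //; apply: vanishingMl.
by apply: bideal_vanishing Ig => s g' /gens_vanishing; apply.
Qed.

(** By Laplace expansion, modulo the entries of row [r0] left of [c], the product of [xx r0 c] with
    an [l.+1]-minor on the first [c] columns is an [l.+2]-minor on the first [b l.+1] columns. All
    other generators are shared by [b] and [upd b l c]. *)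
Lemma bideal_mulxx_upd b r0 c l D a g s :
  pivots b -> (l < r)%N -> (b l < c < b l.+1)%N -> (r0 < M)%N -> (c < n)%N ->
  gens (upd b l c) r0 c s g -> (msize a + s <= D)%N ->
  bideal (gens b r0 c) D.+1 (a * (xx r0 c * g)).
Proof.
move=> pb ltl /andP[ltc clt] ltM ltn Gg.
have old : gens b r0 c s g -> (msize a + s <= D)%N ->
  bideal (gens b r0 c) D.+1 (a * (xx r0 c * g)) by apply: bideal_mulxx_gen.
case: Gg old.
- by move=> i j lti ltiM ltj; apply; apply: gen_row.
- by move=> j ltj _ ltjn; apply; apply: gen_cell.
move=> t u h let_ ltu lth old sz.
case: (t =P l) => [e|/eqP ne]; last first.
  apply: old => //; apply: gen_minor => // d /lth.
  by rewrite /upd (negPf ne).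
subst t; have {}lth d : (d <= l)%N -> (h d < c)%N by move/lth; rewrite /upd eqxx.
have := nminor_scons (xx : nat -> nat -> S) l.+1 r0 c u h.
pose cof (d : 'I_l.+1) : S :=
  (-1) ^+ d.+1 * nminor xx l.+1 u (fun x => scons c h (bump d.+1 x)).
move=> e; have -> : xx r0 c * nminor xx l.+1 u h =
    nminor xx l.+2 (scons r0 u) (scons c h) + \sum_d (- cof d) * xx r0 (h d).
  rewrite e -addrA -big_split big1 ?addr0 //= => d _.
  by rewrite mulNr [cof d * _]mulrC addrN.
rewrite mulrDr; apply: bidealD.
  apply: (bideal1 (s := l.+2)); last by rewrite addnS ltnS.
  apply: gen_minor => // -[|d] //; first by rewrite ltnS => /ltu.
  by rewrite ltnS => /lth lt; apply: ltn_trans clt.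
rewrite mulr_sumr; apply: bideal_sum => d _; rewrite mulrA.
have lthd : (h d < c)%N by apply: lth; rewrite -ltnS.
apply: (bideal1 (s := 1)); first by apply: gen_cell => //; apply: ltn_trans ltn.
have szc : (msize (- cof d) <= l.+2)%N.
  rewrite msizeN /cof -signr_odd; case: (odd _).
    by rewrite expr1 mulN1r msizeN msize_nminor.
  by rewrite expr0 mul1r msize_nminor.
apply: leq_trans (leq_add (msizeM_pred _ _) (leqnn 1)) _.
by move: szc sz; lia.
Qed.

(* When [c] lies strictly between two pivots, the zero locus has a second component,
   obtained by moving the pivot before [c] to [c]. *)
Lemma vanishing_bideal b r0 c D f : pivots b -> (r0 <= M)%N -> (c <= n)%N ->
  (msize f <= D)%N -> vanishing b r0 c f ->
  (forall l, (l < r)%N -> (b l < c < b l.+1)%N -> vanishing (upd b l c) r0 c f) ->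
  bideal (gens b r0 c) D f.
Proof.
(* The factor [n.+1] makes the measure drop also from the end of row [r0] to the start of the next
   row. *)
have [N] := ubnP ((M - r0) * n.+1 + (n - c))%N.
elim: N b r0 c D f => // N IH b r0 c D f ltN pb ler0 lec szf vf vf'.
move: ler0; rewrite leq_eqVlt => /orP[/eqP e|ltM].
  by move: vf; rewrite e; apply: vanishing_bideal_rows.
move: lec; rewrite leq_eqVlt => /orP[/eqP e|ltc].
  subst c; have : bideal (gens b r0.+1 0) D f.
    apply: IH => //; first by nia.
    apply: vanishingW vf => A C U [C1 C2 U0].
    by split=> [i l lt|l _ _|//]; apply: C1 => //; apply: ltnW.
  apply: bideal_sub => s g; case.
  - move=> i j; rewrite ltnS leq_eqVlt => /orP[/eqP ->|lti] ltiM ltj.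
      exact: gen_cell.
    exact: gen_row.
  - by move=> j.
  - by move=> l u h *; apply: gen_minor.
have IHc b' D' f' : pivots b' -> (msize f' <= D')%N -> vanishing b' r0 c.+1 f' ->
  (forall l, (l < r)%N -> (b' l < c.+1 < b' l.+1)%N -> vanishing (upd b' l c.+1) r0 c.+1 f') ->
  bideal (gens b' r0 c.+1) D' f'.
  by move=> *; apply: IH => //; [lia | apply: ltnW].
have vfS : vanishing b r0 c.+1 f by apply: vanishingW vf => A C U; apply: shapedS.
case: (pivots_case pb ltc) => [[l ltl e]|ltc0|[l ltl /andP[ltbl ltbS]]].
- subst c; apply: vanishing_bideal_pivot => // *; exact: IHc.
(* Here [xx r0 c] is a 1-minor on the first [b 0] columns, so the step to [c.+1] does not enlarge
   the ideal. *)
- have : bideal (gens b r0 c.+1) D f.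
    apply: IHc => // l ltl /andP[ltbl _].
    have : (b 0 <= b l)%N by apply: pivots_le pb _; rewrite leq0n ltnW.
    by lia.
  apply: bideal_sub => s g; case.
  + by move=> i j *; apply: gen_row.
  + move=> j; rewrite ltnS leq_eqVlt => /orP[/eqP ->|lti] _ ltj; last exact: gen_cell.
    rewrite -(nminor1 xx (fun=> r0) (fun=> c)).
    by apply: gen_minor.
  + by move=> l u h *; apply: gen_minor.
have pb' : pivots (upd b l c) by apply: pivots_upd; rewrite ?ltbl.
have vf2 : vanishing (upd b l c) r0 c f by apply: vf'; rewrite ?ltbl.
have [] := bideal_split (IHc _ _ _ pb szf vfS _).
  move=> t ltt /andP[lt1 lt2].
  have -> : t = l.
    case: (ltngtP t l) => // lt.
      suff : (b t.+1 <= b l)%N by lia.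
      by apply: pivots_le pb _; rewrite lt ltnW.
    suff : (b l.+1 <= b t)%N by lia.
    by apply: pivots_le pb _; rewrite lt ltnW.
  by apply: vanishingW vf2 => A C U; apply: shaped_upd; apply: ltnW.
move=> g [h [Ig szh ef]]; rewrite ef; apply: bidealD => //.
case: D szf szh Ig => [|D] szf szh Ig.
  move: szh; rewrite leqn0 msize_poly_eq0 => /eqP ->; rewrite mulr0; exact: bideal0.
(* Since [c] is a pivot of [upd b l c], the pivot case places [h] in the ideal of the second
   component, which [xx r0 c] multiplies into the ideal of [b]. *)
apply: (@bideal_mulxx _ _ _ (gens (upd b l c) r0 c)).
  by move=> a g' s; apply: bideal_mulxx_upd; rewrite ?ltbl.
have ec : upd b l c l = c by rewrite /upd eqxx.
rewrite -{2}ec; apply: vanishing_bideal_pivot => //.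
  by rewrite ec => D' f' *; apply: IHc.
apply: vanishing_cancel_pivot => //; rewrite ec.
have -> : xx r0 c * h = f + (-1) * g by rewrite ef; ring.
apply: vanishingD => //; apply: vanishingMl.
(* The values of [b] are at most those of [upd b l c], so generators for [b] also vanish on the
   second component. *)
apply: bideal_vanishing Ig => s g' Gg'; apply: (@gens_vanishing _ _ _ _ _ _ _ _ _ s) => //.
case: Gg' => [||t u w let_ ltu ltw] *; [exact: gen_row | exact: gen_cell | ].
apply: gen_minor => // d /ltw lt; apply: leq_trans lt _; rewrite /upd.
by case: eqP => // ->; apply: ltnW.
Qed.

End HochsterEagon.

(** * Powers of ideals *)

Section IdealPowers.
Variable R : comNzRingType.

Lemma in_idealM (P Q T : R -> Prop) f g :
  (forall a b, P a -> Q b -> in_ideal T (a * b)) ->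
  in_ideal P f -> in_ideal Q g -> in_ideal T (f * g).
Proof.
move=> PQ If Ig; elim/in_ideal_ind: f / If => [|f1 f2 I1 I2|a u Pu].
- by rewrite mul0r; apply: in_ideal0.
- by rewrite mulrDl; apply: in_idealD.
rewrite -mulrA; apply: in_idealMl.
elim/in_ideal_ind: g / Ig => [|g1 g2 I1 I2|b v Qv].
- by rewrite mulr0; apply: in_ideal0.
- by rewrite mulrDr; apply: in_idealD.
by rewrite mulrCA; apply/in_idealMl/PQ.
Qed.

Variables (I : finType) (Z : I -> R).

(** The [e]-th power of the ideal generated by the [Z i]; admitting larger exponent sums makes
    monotonicity in [e] immediate. *)
Definition idpow (e : nat) : R -> Prop := in_ideal (fun g =>
  exists2 u : I -> nat, (e <= \sum_i u i)%N & g = \prod_i Z i ^+ u i).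

Lemma idpow0 f : idpow 0 f.
Proof.
rewrite -[f]mulr1; apply/in_idealMl/in_ideal_gen; exists (fun=> 0%N) => //.
by rewrite big1.
Qed.

Lemma idpow_gen i : idpow 1 (Z i).
Proof.
apply: in_ideal_gen; exists (fun j => j == i : nat).
  by rewrite (bigD1 i) //= eqxx.
rewrite (bigD1 i) //= eqxx expr1 big1 ?mulr1 // => j /negPf->.
by rewrite expr0.
Qed.

Lemma idpow_leq e1 e2 f : (e1 <= e2)%N -> idpow e2 f -> idpow e1 f.
Proof.
move=> le12; apply: in_ideal_sub => g [u le2 ->]; apply: in_ideal_gen.
by exists u => //; apply: leq_trans le2.
Qed.

Lemma idpowM e1 e2 f g : idpow e1 f -> idpow e2 g -> idpow (e1 + e2) (f * g).
Proof.
apply: in_idealM => _ _ [u leu ->] [v lev ->]; apply: in_ideal_gen.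
exists (fun i => (u i + v i)%N); first by rewrite big_split leq_add.
by rewrite -big_split; apply: eq_bigr => i _; rewrite exprD.
Qed.

Lemma idpow_prod (J : Type) (s : seq J) (P : pred J) (w : J -> nat) (F : J -> R) :
  (forall j, P j -> idpow (w j) (F j)) ->
  idpow (\sum_(j <- s | P j) w j) (\prod_(j <- s | P j) F j).
Proof.
move=> wF; apply: (big_ind2 idpow) => //; first exact: idpow0.
by move=> *; apply: idpowM.
Qed.

Lemma idpowX e f t : idpow e f -> idpow (e * t) (f ^+ t).
Proof.
move=> If; elim: t => [|t IH]; first by rewrite muln0; apply: idpow0.
by rewrite mulnS exprS; apply: idpowM.
Qed.

Lemma idpow_pigeonhole p f : (0 < p)%N -> idpow (#|I| * p.-1).+1 f ->
  in_ideal (fun g => exists i, g = Z i ^+ p) f.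
Proof.
move=> p_gt0; apply: in_ideal_sub => _ [u lt ->].
have [i lepi] : exists i, (p <= u i)%N.
  apply/existsP; rewrite -[X in is_true X]negbK negb_exists; apply/negP => /forallP ltu.
  move: lt; rewrite ltnNge => /negP[]; rewrite -sum_nat_const; apply: leq_sum => i _.
  by have := ltu i; rewrite -ltnNge; lia.
rewrite (bigD1 i) //= -(subnKC lepi) exprD -mulrA mulrC; apply/in_idealMl/in_ideal_gen.
by exists i.
Qed.

(* [det (W + A B)] is the determinant of the block matrix [1, B; -A, W], and each
   term of its Leibniz expansion can avoid the block [W] in at most [q] rows. *)
Lemma idpow_det (q s : nat) (A B W : nat -> nat -> R) (E : nat -> bool) :
  (forall a b, (a < s)%N -> (b < s)%N -> E a -> idpow 1 (W a b)) ->
  idpow (\sum_(a < s) E a - q)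
    (\det (\matrix_(a < s, b < s) (\sum_(l < q) A a l * B l b + W a b))).
Proof.
move=> EW.
pose A' := (\matrix_(a < s, l < q) A a l) : 'M[R]_(s, q).
pose B' := (\matrix_(l < q, b < s) B l b) : 'M[R]_(q, s).
pose W' := (\matrix_(a < s, b < s) W a b) : 'M[R]_s.
have -> : \matrix_(a < s, b < s) (\sum_(l < q) A a l * B l b + W a b) = W' + A' *m B'.
  apply/matrixP => a b; rewrite !mxE addrC; congr (_ + _).
  by apply: eq_bigr => l _; rewrite !mxE.
pose T := block_mx 1%:M B' (- A') W'.
have <- : \det T = \det (W' + A' *m B').
  have -> : T = block_mx 1%:M 0 (- A') 1%:M *m block_mx 1%:M B' 0 (W' + A' *m B').
    rewrite mulmx_block !mul1mx !mul0mx !mulmx1 ?mulmx0 !addr0.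
    by rewrite mulNmx addrCA addNr addr0.
  by rewrite det_mulmx det_lblock det_ublock !det1 !mul1r.
rewrite /determinant; apply: (big_ind (idpow _)); first exact: in_ideal0.
  exact: in_idealD.
move=> sg _; apply: in_idealMl.
(* Marks the rows in which the term for [sg] takes a factor of [W] known to lie in the ideal. *)
pose w (i : 'I_(q + s)) : nat := [&& (q <= i)%N, E (i - q)%N & (q <= sg i)%N].
apply: (@idpow_leq _ (\sum_i w i)%N); last first.
  apply: idpow_prod => i _; rewrite /w; case: (boolP (_ && _)) => [|_]; last exact: idpow0.
  case/and3P; rewrite /T.
  case: (splitP i) => [a ei|a ei]; first by rewrite ei leqNgt ltn_ord.
  case: (splitP (sg i)) => [b eb|b eb] _; first by rewrite eb leqNgt ltn_ord.
  have -> : i = rshift q a by apply: val_inj.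
  have -> : sg (rshift q a) = rshift q b.
    by apply: val_inj => /=; rewrite -eb; congr (nat_of_ord (sg _)); apply: val_inj.
  by rewrite block_mxEdr mxE /= addKn => Ea _; apply: EW.
(* A permutation takes values below [q] exactly [q] times, so at most [q] of the last [s] rows leave
   the block [W]. *)
have cntq : (\sum_(a < s) (sg (rshift q a) < q) <= q)%N.
  have : (\sum_(i < q + s) (sg i < q) = q)%N.
    rewrite (reindex_inj (@perm_inj _ sg^-1%g)) /=.
    under eq_bigr do rewrite permKV.
    rewrite big_split_ord /= (eq_bigr (fun=> 1%N)) => [|i _]; last by rewrite ltn_ord.
    rewrite sum_nat_const card_ord muln1 big1 ?addn0 // => i _.
    by rewrite ltnNge leq_addr.
  by rewrite big_split_ord /= => e; apply: leq_trans (leq_addl _ _) (eq_leq e).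
rewrite leq_subLR big_split_ord /= addnCA; apply: leq_trans (leq_addl _ _).
apply: leq_trans (leq_add cntq (leqnn _)); rewrite -big_split; apply: leq_sum => a _ /=.
by rewrite /w /= leq_addr addKn ltnNge; case: (E a); case: (q <= _)%N.
Qed.

End IdealPowers.

Definition border q i a := if (a < q)%N then a else i : nat.

(** Expansion along the last column. The coefficients [c l] do not depend on [j]: scaled by the
    corner minor, row [i] is a row of bordered minors plus one combination of the first [q] rows. *)
Lemma nminor_border (R : comNzRingType) (F : nat -> nat -> R) q i j
  (c := fun l => (-1) ^+ (l + q) * nminor F q (fun x => border q i (bump l x)) id) :
  nminor F q id id * F i j =
  nminor F q.+1 (border q i) (border q j) + \sum_(l < q) - c l * F l j.
Proof.
have bq (x : 'I_q) : bump q x = x by rewrite /bump leqNgt ltn_ord.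
have -> : nminor F q.+1 (border q i) (border q j) =
    \sum_(l < q) F l j * c l + F i j * nminor F q id id.
  rewrite [LHS]/nminor (expand_det_col _ ord_max) big_ord_recr /=; congr (_ + _).
    apply: eq_bigr => l _; rewrite mxE /= {1 2}/border ltn_ord ltnn /c /cofactor /= /nminor.
    congr (_ * (_ * \det _)); apply/matrixP => a b; rewrite !mxE /=.
    congr (F _ _).
    by rewrite bq /border ltn_ord.
  rewrite mxE /= {1 2}/border ltnn /cofactor /= addnn -signr_odd odd_double expr0 mul1r /nminor.
  congr (_ * \det _); apply/matrixP => a b; rewrite !mxE /=.
  by rewrite !bq /border !ltn_ord.
move: (nminor F q id id) => d; clearbody c.
rewrite addrAC -big_split big1 /= ?add0r ?[d * _]mulrC // => l _.
by rewrite [F l j * _]mulrC mulNr addrN.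
Qed.

(** * Localization at the top left minor *)

(** This determinant is the characteristic polynomial of [- C], hence monic. *)
Lemma char_poly_neq0 (A : idomainType) (q : nat) (C : nat -> nat -> A) :
  \det (\matrix_(a < q, b < q) deform (fun i j => i == j) C a b) != 0.
Proof.
suff -> : \matrix_(a < q, b < q) deform (fun i j => i == j) C a b =
    char_poly_mx (\matrix_(a < q, b < q) - C a b).
  exact: monic_neq0 (char_poly_monic _).
apply/matrixP => a b; rewrite !mxE /deform polyCN opprK addrC.
by rewrite mulr_natl val_eqE.
Qed.

Section MinorsOfTopRows.
Variables (k : fieldType) (m n M r : nat).
Local Notation S := {mpoly k[m * n]}.

Definition top_minor (g : S) : Prop := exists f h,
  [/\ forall a, (a <= r)%N -> (f a < M)%N, forall a, (a <= r)%N -> (h a < n)%N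
    & g = nminor xx r.+1 f h].

Definition corner : S := nminor xx r id id.

Definition bordered (ij : 'I_(M - r) * 'I_(n - r)) : S :=
  nminor xx r.+1 (border r (r + ij.1)%N) (border r (r + ij.2)%N).

Lemma bordered_top_minor ij : top_minor (bordered ij).
Proof.
case: ij => [[i lti] [j ltj]]; exists (border r (r + i)%N), (border r (r + j)%N).
by split=> // a lea; rewrite /border; case: (ltnP a r) => _; lia.
Qed.

Lemma idpow_bordered i j : (i < M)%N -> (j < n)%N ->
  idpow bordered 1 (nminor xx r.+1 (border r i) (border r j)).
Proof.
move=> lti ltj; case: (ltnP i r) => [ltir|leri].
  suff -> : nminor xx r.+1 (border r i) (border r j) = 0 :> S by apply: in_ideal0.
  by apply: (@nminor_row_eq _ _ _ _ _ i r); rewrite ?ltir ?ltnSn // /border ltir ltnn.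
case: (ltnP j r) => [ltjr|lerj].
  suff -> : nminor xx r.+1 (border r i) (border r j) = 0 :> S by apply: in_ideal0.
  by apply: (@nminor_col_eq _ _ _ _ _ j r); rewrite ?ltjr ?ltnSn // /border ltjr ltnn.
have lti' : (i - r < M - r)%N by lia.
have ltj' : (j - r < n - r)%N by lia.
have := idpow_gen bordered (Ordinal lti', Ordinal ltj').
by rewrite /bordered /= !subnKC.
Qed.

(** Scaling every row by [corner] turns the rows among the first [M] into bordered minors plus
    combinations of the first [r] rows of the matrix; by [idpow_det] this rank [r] part costs at
    most [r] in the exponent. *)
Lemma idpow_nminor s (f h : nat -> nat) : (forall b, (b < s)%N -> (h b < n)%N) ->
  idpow bordered (\sum_(a < s) (f a < M) - r) (corner ^+ s * nminor xx s f h).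
Proof.
move=> lth; pose c i l : S := - ((-1) ^+ (l + r) *
  nminor xx r (fun x => border r i (bump l x)) id).
have -> : corner ^+ s * nminor xx s f h =
    \det (\matrix_(a < s, b < s)
      (\sum_(l < r) (if (f a < M)%N then c (f a) l else 0) * xx l (h b) +
       (if (f a < M)%N then nminor xx r.+1 (border r (f a)) (border r (h b))
        else corner * xx (f a) (h b)))).
  rewrite {1}/nminor -detZ; congr (\det _); apply/matrixP => a b; rewrite !mxE.
  case: ifP => _; last by rewrite big1 ?add0r // => l _; rewrite mul0r.
  by rewrite /corner nminor_border addrC.
apply: (@idpow_det _ _ _ r s (fun a l => if (f a < M)%N then c (f a) l else 0)
  (fun l b => xx l (h b)) (fun a b => if (f a < M)%N then
     nminor xx r.+1 (border r (f a)) (border r (h b)) else corner * xx (f a) (h b))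
  (fun a => (f a < M)%N)) => a b _ ltb ltfa.
by rewrite ltfa; apply: idpow_bordered; rewrite ?lth.
Qed.

Definition local_idpow e (f : S) := exists t, idpow bordered e (corner ^+ t * f).

Lemma local_idpow_nminor s (f h : nat -> nat) e : (forall b, (b < s)%N -> (h b < n)%N) ->
  (e + r <= \sum_(a < s) (f a < M))%N -> local_idpow e (nminor xx s f h).
Proof.
move=> lth le; exists s; apply: idpow_leq (idpow_nminor f lth).
by rewrite leq_subRL 1?addnC // (leq_trans _ le) // leq_addl.
Qed.

Lemma local_idpow0 f : local_idpow 0 f.
Proof. by exists 0%N; apply: idpow0. Qed.

Lemma local_idpow_leq e1 e2 f : (e1 <= e2)%N -> local_idpow e2 f -> local_idpow e1 f.
Proof. by move=> le [t If]; exists t; apply: idpow_leq If. Qed.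

Lemma local_idpowM e1 e2 f g :
  local_idpow e1 f -> local_idpow e2 g -> local_idpow (e1 + e2) (f * g).
Proof.
move=> [t1 I1] [t2 I2]; exists (t1 + t2)%N.
by rewrite exprD mulrACA; apply: idpowM.
Qed.

Lemma local_idpowX e f t : local_idpow e f -> local_idpow (e * t) (f ^+ t).
Proof. by case=> s If; exists (s * t)%N; rewrite exprM -exprMn; apply: idpowX. Qed.

Lemma local_idpow_prod (J : eqType) (s : seq J) (w : J -> nat) (F : J -> S) :
  (forall j, j \in s -> local_idpow (w j) (F j)) ->
  local_idpow (\sum_(j <- s) w j) (\prod_(j <- s) F j).
Proof.
move=> wF; rewrite !big_seq; apply: (big_ind2 local_idpow) => //.
  exact: local_idpow0.
by move=> *; apply: local_idpowM.
Qed.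

Lemma top_minor_local_idpow f : in_ideal top_minor f -> local_idpow 1 f.
Proof.
move=> If; elim/in_ideal_ind: f / If => [|f g [t1 I1] [t2 I2]|a g [u [h [ltu lth ->]]]].
- by exists 0%N; rewrite mulr0; apply: in_ideal0.
- exists (t1 + t2)%N; rewrite mulrDr exprD; apply: in_idealD.
    by rewrite [corner ^+ t1 * _]mulrC -mulrA; apply: in_idealMl.
  by rewrite -mulrA; apply: in_idealMl.
rewrite -[1%N]add0n; apply: local_idpowM; first exact: local_idpow0.
apply: local_idpow_nminor => [b|]; first exact: lth.
rewrite (eq_bigr (fun=> 1%N)) => [|a' _]; last by rewrite ltu // -ltnS.
by rewrite sum_nat_const card_ord muln1.
Qed.

Hypotheses (leMm : (M <= m)%N) (lerM : (r <= M)%N) (lern : (r <= n)%N).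
Local Notation vanishing := (@vanishing k m n M r).

(** With [r0 = c = 0] this leaves [C] free and makes [U] upper trapezoidal. Generators with [l < r]
    pick [l.+1] columns among [l] and are zero, so only the [r.+1]-minors remain. *)
Definition pivots0 l := if (l < r)%N then l else n.

Lemma pivots0P : pivots n r pivots0.
Proof.
rewrite /pivots0; split=> [|l ltl]; first by rewrite ltnn.
by rewrite ltl; case: ifP => // _; apply: leq_trans lern.
Qed.

Lemma vanishing_top_minor f : vanishing pivots0 0 0 f -> in_ideal top_minor f.
Proof.
move=> vf; have : bideal (gens M r pivots0 0 0) (msize f) f.
  by apply: vanishing_bideal => //; apply: pivots0P.
elim=> [|a g f' s Gg _ _ IH]; first exact: in_ideal0.
apply: in_idealD IH; apply: in_idealMl.
case: Gg => // l u h; rewrite leq_eqVlt => /orP[/eqP ->|ltl] ltu lth.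
  by apply: in_ideal_gen; exists u, h; split=> // t /lth; rewrite /pivots0 ltnn.
have {}lth t : (t <= l)%N -> (h t < l)%N by move/lth; rewrite /pivots0 ltl.
suff -> : nminor xx l.+1 u h = 0 :> S by apply: in_ideal0.
have [inj|] := boolP (injectiveb (fun a : 'I_l.+1 => Ordinal (lth a (ltn_ord a)))).
  by have := leq_card _ (injectiveP _ inj); rewrite !card_ord ltnn.
case/injectivePn => a1 [a2 ne12 [e12]].
wlog lt12 : a1 a2 ne12 e12 / (a1 < a2)%N.
  move=> H; case: (ltngtP a1 a2) => [lt|lt|/val_inj e].
  - exact: (H a1 a2).
  - by apply: (H a2 a1) => //; rewrite eq_sym.
  - by rewrite e eqxx in ne12.
by apply: (@nminor_col_eq _ _ _ _ _ a1 a2); rewrite // lt12 ltn_ord.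
Qed.

Lemma top_minor_vanishing f : in_ideal top_minor f -> vanishing pivots0 0 0 f.
Proof.
move=> If; elim/in_ideal_ind: f / If => [|f g|a g [u [h [ltu lth ->]]]].
- by move=> A iota C U W _; rewrite rmorph0.
- exact: vanishingD.
apply: vanishingMl; apply: (@gens_vanishing _ _ _ _ _ leMm _ _ _ r.+1); first exact: pivots0P.
by apply: gen_minor => // t /lth; rewrite /pivots0 ltnn.
Qed.

(** Deforming both factors by the identity makes the value of [corner] a product of two
    characteristic polynomials. *)
Lemma vanishing_corner f : vanishing pivots0 0 0 (corner * f) -> vanishing pivots0 0 0 f.
Proof.
apply: (@vanishing_cancel _ _ _ _ _ _ _ _ (fun i j => i == j) (fun i j => i == j)).
  move=> A; split=> // l j ltl; rewrite /pivots0 ltl => ltj.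
  by rewrite gtn_eqF.
move=> A iota C U W _; rewrite /corner evalat_nminor; first last.
- by move=> a lta; apply: leq_trans lern.
- by move=> a lta; apply: leq_trans (leq_trans lerM leMm).
suff -> : nminor (factored M r (deform (fun i j => i == j) C) (deform (fun i j => i == j) U)
    (fun i j => (W i j)%:P)) r id id =
    \det (\matrix_(a < r, b < r) deform (fun i j => i == j) C a b) *
    \det (\matrix_(a < r, b < r) deform (fun i j => i == j) U a b).
  by rewrite mulf_neq0 ?char_poly_neq0.
rewrite -det_mulmx; congr (\det _); apply/matrixP => a b; rewrite !mxE /factored.
rewrite (leq_trans (ltn_ord a) lerM); apply: eq_bigr => l _.
by rewrite !mxE.
Qed.

Lemma in_ideal_cornerX t f : in_ideal top_minor (corner ^+ t * f) -> in_ideal top_minor f.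
Proof.
move/top_minor_vanishing => vf; apply: vanishing_top_minor.
elim: t vf => [|t IH]; first by rewrite expr0 mul1r.
by rewrite exprS -mulrA => /vanishing_corner.
Qed.

(* Away from [corner] the ideal is generated by the [(M - r) (n - r)] bordered
   minors, so [D ^+ p.-1 * f] lies in the ideal of their [p]-th powers there. *)
Lemma compatible_top_minor p (Phi : S -> S) (D : S) : (0 < p)%N ->
  (forall f g, Phi (f + g) = Phi f + Phi g) -> (forall f g, Phi (f * g ^+ p) = Phi f * g) ->
  local_idpow ((M - r) * (n - r)) D ->
  compatible (fun f => Phi (D ^+ p.-1 * f)) (in_ideal top_minor).
Proof.
move=> p_gt0 PhiD PhiM ID f If.
have [t It] := local_idpowM (local_idpowX p.-1 ID) (top_minor_local_idpow If).
(* The power of [corner] enters [Phi] as a [p]-th power: one copy of [corner ^+ t] clears the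
   denominator, the others are spare. *)
apply: (@in_ideal_cornerX t); rewrite mulrC -PhiM.
have : in_ideal (fun g => exists ij, g = bordered ij ^+ p) (D ^+ p.-1 * f * (corner ^+ t) ^+ p).
  have -> : D ^+ p.-1 * f * (corner ^+ t) ^+ p =
      (corner ^+ t) ^+ p.-1 * (corner ^+ t * (D ^+ p.-1 * f)).
    by rewrite [RHS]mulrA -exprSr prednK // mulrC.
  apply/in_idealMl/idpow_pigeonhole => //.
  by rewrite card_prod !card_ord -addn1.
have Phi0 : Phi 0 = 0 by apply: (@addrI _ (Phi 0)); rewrite -PhiD !addr0.
elim/in_ideal_ind => [|g1 g2 I1 I2|a _ [ij ->]].
- by rewrite Phi0; apply: in_ideal0.
- by rewrite PhiD; apply: in_idealD.
by rewrite PhiM; apply/in_idealMl/in_ideal_gen/bordered_top_minor.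
Qed.

End MinorsOfTopRows.

(** * The Frobenius trace *)

Section FrobeniusTrace.
Variables (k : fieldType) (N p : nat) (rt : k -> k).
Hypotheses (charp : p \in [pchar k]) (rtK : forall c, rt c ^+ p = c).
Local Notation S := {mpoly k[N]}.

Let p_gt0 : (0 < p)%N. Proof. exact: prime_gt0 (pcharf_prime charp). Qed.

(** Injectivity of Frobenius makes [rt] a two-sided inverse and transfers additivity and
    multiplicativity to it. *)
Lemma expr_pchar_inj : injective (fun c : k => c ^+ p).
Proof.
move=> a b /eqP; rewrite -subr_eq0 -[_ - _](pFrobenius_autB_comm charp (mulrC a b)).
by rewrite pFrobenius_autE expf_eq0 p_gt0 subr_eq0 => /eqP.
Qed.

Lemma rtX c : rt (c ^+ p) = c.
Proof. by apply: expr_pchar_inj; rewrite rtK. Qed.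

Lemma rt0 : rt 0 = 0.
Proof. by rewrite -[in RHS](rtX 0) expr0n gtn_eqF. Qed.

Lemma rt1 : rt 1 = 1.
Proof. by rewrite -[in RHS](rtX 1) expr1n. Qed.

Lemma rtD a b : rt (a + b) = rt a + rt b.
Proof.
apply: expr_pchar_inj; rewrite rtK -[RHS](pFrobenius_autE charp).
by rewrite pFrobenius_autD_comm ?pFrobenius_autE ?rtK //; apply: mulrC.
Qed.

Lemma rtM a b : rt (a * b) = rt a * rt b.
Proof. by apply: expr_pchar_inj; rewrite exprMn !rtK. Qed.

(** The unique exponent that the trace sends to [u]. *)
Definition trace_mnm (u : 'X_{1..N}) : 'X_{1..N} := [multinom (u i * p + p.-1)%N | i < N].

Lemma trace_mnmD b u : trace_mnm (b + u) = (b *+ p + trace_mnm u)%MM.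
Proof. by apply/mnmP => i; rewrite !(mnmE, mnmDE, mulmnE) mulnDl addnA. Qed.

Lemma frob_trace_coeff (f : S) u : (frob_trace p rt f)@_u = rt f@_(trace_mnm u).
Proof.
rewrite /frob_trace raddf_sum /=.
have cond (a : 'X_{1..N}) : [forall i, (a i %% p == p.-1)%N] ->
    ([multinom (a i %/ p)%N | i < N] == u) = (a == trace_mnm u).
  move=> /forallP am; apply/eqP/eqP => [<-|->]; apply/mnmP => i; rewrite !mnmE.
    by rewrite [LHS](divn_eq _ p) (eqP (am i)).
  by rewrite divnMDl // divn_small ?addn0 // prednK.
have cond' : [forall i, (trace_mnm u i %% p == p.-1)%N].
  by apply/forallP => i; rewrite mnmE modnMDl modn_small // prednK.
rewrite big_mkcond (eq_bigr (fun a => if a == trace_mnm u then rt f@_a else 0)) /=; last first.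
  move=> a _; case: ifPn => [/cond am|nc].
    by rewrite mcoeffZ mcoeffX am; case: eqP; rewrite ?mulr1 ?mulr0.
  by case: eqP => // e; rewrite e cond' in nc.
have [uf|nuf] := boolP (trace_mnm u \in msupp f).
  by rewrite (bigD1_seq (trace_mnm u)) //= eqxx big1 ?addr0 // => a /negPf->.
rewrite big_seq big1 => [|a af]; last first.
  by case: eqP => // e; rewrite e (negPf nuf) in af.
by move: nuf; rewrite -mcoeff_eq0 => /eqP ->; rewrite rt0.
Qed.

Lemma frob_traceD (f g : S) :
  frob_trace p rt (f + g) = frob_trace p rt f + frob_trace p rt g.
Proof. by apply/mpolyP => u; rewrite mcoeffD !frob_trace_coeff mcoeffD rtD. Qed.

Lemma mcoeffMX_eq0 (f : S) (b w : 'X_{1..N}) : ~~ (b <= w)%MM -> (f * 'X_[b])@_w = 0.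
Proof.
move=> nle; apply/eqP; rewrite mcoeff_eq0 (perm_mem (msuppMX _ _)).
by apply: contra nle => /mapP[w' _ ->]; apply: lem_addr.
Qed.

(** Both sides are additive in [g], so a single term suffices; for it the factor [x^(p b)] inside
    the trace becomes a shift by [b] outside. *)
Lemma frob_traceM (f g : S) : frob_trace p rt (f * g ^+ p) = frob_trace p rt f * g.
Proof.
have charS : p \in [pchar S] by rewrite pchar_lalg.
pose Q (g : S) := forall f : S, frob_trace p rt (f * g ^+ p) = frob_trace p rt f * g.
suff : Q g by apply.
rewrite [g]mpolyE; apply: (big_ind Q).
- move=> f'; rewrite mulr0 expr0n gtn_eqF //= mulr0.
  by apply/mpolyP => u; rewrite frob_trace_coeff !mcoeff0 rt0.
- move=> g1 g2 Q1 Q2 f'; rewrite -(pFrobenius_autE charS).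
  rewrite pFrobenius_autD_comm; last exact: mulrC.
  by rewrite !pFrobenius_autE !mulrDr frob_traceD Q1 Q2.
move=> b _ f'; apply/mpolyP => u; set c := g@_b.
rewrite frob_trace_coeff exprZn mpolyXn -!scalerAr !mcoeffZ rtM rtX; congr (_ * _).
have [leb|nleb] := boolP (b <= u)%MM.
  by rewrite -(submK leb) addmC trace_mnmD !mcoeffMX frob_trace_coeff.
(* From [p b_i <= p u_i + p - 1] follows [b_i <= u_i], so both coefficients are zero if [x^b] does
   not divide [x^u]. *)
rewrite !mcoeffMX_eq0 ?rt0 //; apply: contra nleb => /mnm_lepP le.
apply/mnm_lepP => i; have := le i; rewrite mulmnE mnmE.
by apply: contraTT; rewrite -!ltnNge => lt; have := leq_mul lt (leqnn p); rewrite mulSn; lia.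
Qed.

End FrobeniusTrace.

(** * Minors with arbitrary and with increasing indices *)

Lemma perm_increasing (s q : nat) (f : 'I_s -> 'I_q) : injective f ->
  exists pi : 'S_s, forall a b : 'I_s, (a < b)%N -> (f (pi a) < f (pi b))%N.
Proof.
move=> injf; pose le := fun x y : 'I_q => (x <= y)%N.
pose t := [tuple f i | i < s]; pose t' := [tuple of sort le t].
have /tuple_permP[pi e] : perm_eq t' t by rewrite perm_sort.
have {}e a : tnth t' a = f (pi a).
  by rewrite (val_inj e : t' = _) tnth_mktuple tnth_mktuple.
exists pi => a b ltab; rewrite ltn_neqAle; apply/andP; split.
  by apply: contraTneq ltab => /val_inj/injf/perm_inj ->; rewrite ltnn.
have le_trans : transitive le by move=> x y z; apply: leq_trans.
have srt : sorted le t' by apply: sort_sorted => x y; apply: leq_total.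
have := sorted_ltn_nth le_trans (f a) srt; rewrite size_tuple => /(_ a b).
by rewrite !inE !ltn_ord -!tnth_nth !e; apply.
Qed.

Lemma det_perm_rows (R : comNzRingType) s (pi : 'S_s) (F : 'I_s -> 'I_s -> R) :
  \det (\matrix_(a, b) F a b) = (-1) ^+ pi * \det (\matrix_(a, b) F (pi a) b).
Proof.
have -> : \matrix_(a, b) F (pi a) b = row_perm pi (\matrix_(a, b) F a b).
  by apply/matrixP => a b; rewrite !mxE.
by rewrite row_permE det_mulmx det_perm mulrA -expr2 sqrr_sign mul1r.
Qed.

(** A repeated index makes the determinant zero; otherwise sorting the rows and columns changes only
    the sign. *)
Lemma in_ideal_minor (R : comNzRingType) (q n s : nat) (A : 'M[R]_(q, n))
  (f : 'I_s -> 'I_q) (h : 'I_s -> 'I_n) :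
  in_ideal (is_minor s A) (\det (\matrix_(a, b) A (f a) (h b))).
Proof.
have [/injectiveP injf|] := boolP (injectiveb f); last first.
  case/injectivePn => a1 [a2 ne e].
  by rewrite (determinant_alternate ne) => [|b]; [apply: in_ideal0 | rewrite !mxE e].
have [/injectiveP injh|] := boolP (injectiveb h); last first.
  case/injectivePn => a1 [a2 ne e]; rewrite -det_tr.
  by rewrite (determinant_alternate ne) => [|b]; [apply: in_ideal0 | rewrite !mxE e].
have [pi incf] := perm_increasing injf; have [ro inch] := perm_increasing injh.
rewrite (det_perm_rows pi (fun a b => A (f a) (h b))); apply: in_idealMl.
have -> : \det (\matrix_(a, b) A (f (pi a)) (h b)) =
    \det (\matrix_(b, a) A (f (pi a)) (h b)).
  by rewrite -det_tr; congr (\det _); apply/matrixP => a b; rewrite !mxE.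
rewrite (det_perm_rows ro (fun b a => A (f (pi a)) (h b))).
apply/in_idealMl/in_ideal_gen; exists (f \o pi), (h \o ro); split=> //; split=> //.
by rewrite -det_tr; congr (\det _); apply/matrixP => a b; rewrite !mxE.
Qed.

Lemma It_top_minor (k : fieldType) (m n q r : nat) (A : 'M[{mpoly k[m * n]}]_(q, n)) f :
  (forall i j, A i j = xx i j) ->
  It r.+1 A f <-> in_ideal (@top_minor k m n q r) f.
Proof.
move=> AE; split; apply: in_ideal_sub => g.
  case=> u [h [_ [_ ->]]]; apply: in_ideal_gen.
  exists (fun a => u (inord a)), (fun a => h (inord a)).
  split; [by move=> a _; apply: ltn_ord | by move=> a _; apply: ltn_ord |].
  by congr (\det _); apply/matrixP => a b; rewrite !mxE AE !inord_val.
case=> u [h [ltu lth ->]].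
pose u' (a : 'I_r.+1) := Ordinal (ltu a (ltn_ord a)).
pose h' (a : 'I_r.+1) := Ordinal (lth a (ltn_ord a)).
suff -> : nminor xx r.+1 u h = \det (\matrix_(a, b) A (u' a) (h' b)) by apply: in_ideal_minor.
by congr (\det _); apply/matrixP => a b; rewrite !mxE AE.
Qed.

(** * Leading terms *)

(** A permutation preserves the sum of the indices, so only the sum of [a * sg a] varies; there
    [2 a sg(a) <= a^2 + sg(a)^2], with equality only at fixed points. *)
Lemma sum_perm_lt s (x y : nat) (sg : 'S_s) : sg != 1%g ->
  (\sum_(a < s) (x + a) * (y + sg a) < \sum_(a < s) (x + a) * (y + a))%N.
Proof.
move=> ne1.
have sumE (F : nat -> nat) : (\sum_(a < s) F (sg a) = \sum_(a < s) F a)%N.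
  by rewrite [RHS](reindex_inj (@perm_inj _ sg)).
have expand (ta : 'I_s -> nat) : (\sum_(a < s) ta a = \sum_(a < s) a ->
    \sum_(a < s) (x + a) * (y + ta a) =
    \sum_(a < s) x * y + x * \sum_(a < s) a + y * \sum_(a < s) a + \sum_(a < s) a * ta a)%N.
  move=> eta; rewrite -{1}eta !big_distrr -!big_split /=.
  by apply: eq_bigr => a _; rewrite mulnDl !mulnDr; ring.
rewrite (expand (fun a => sg a) (sumE id)) (expand (fun a => a : nat)) // ltn_add2l.
rewrite -(ltn_pmul2l (isT : (0 < 2)%N)).
have -> : (2 * \sum_(a < s) a * a = \sum_(a < s) (a ^ 2 + sg a ^ 2))%N.
  by rewrite big_split /= (sumE (fun a => a ^ 2)%N) addnn -mul2n.
rewrite big_distrr /=.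
have le_eq := leqif_sum (fun (a : 'I_s) (_ : true) => nat_Cauchy a (sg a)).
rewrite (ltn_leqif le_eq); apply: contra ne1 => /forallP eq_sg; apply/eqP/permP => a.
by rewrite perm1; apply/val_inj/esym/eqP/(implyP (eq_sg a)).
Qed.

Section Weights.
Variables (k : fieldType) (m n : nat).
Local Notation S := {mpoly k[m * n]}.
Local Notation T := 'X_{1..m * n}.
Implicit Types (u v : T) (f g : S).

Definition wt u : nat := \sum_(i < m) \sum_(j < n) u (mxvec_index i j) * (i.+1 * j.+1).

Lemma wt0 : wt 0%MM = 0%N.
Proof. by rewrite /wt big1 // => i _; rewrite big1 // => j _; rewrite mnm0E. Qed.

Lemma wtD u v : wt (u + v)%MM = (wt u + wt v)%N.
Proof.
rewrite /wt -big_split; apply: eq_bigr => i _; rewrite -big_split.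
by apply: eq_bigr => j _; rewrite mnmDE mulnDl.
Qed.

Lemma wt_sum (I : Type) (s : seq I) (P : pred I) (F : I -> T) :
  wt (\sum_(i <- s | P i) F i)%MM = (\sum_(i <- s | P i) wt (F i))%N.
Proof. by apply: (big_morph wt wtD wt0). Qed.

Lemma wt_gt0 u : u != 0%MM -> (0 < wt u)%N.
Proof.
apply: contraR; rewrite -eqn0Ngt /wt sum_nat_eq0 => /forallP ui; apply/eqP/mnmP => q.
case/mxvec_indexP: q => i j; rewrite mnm0E; apply/eqP.
have /implyP/(_ isT) := ui i; rewrite sum_nat_eq0 => /forallP/(_ j)/implyP/(_ isT).
by rewrite muln_eq0 orbF.
Qed.

Definition cell (i j : nat) : T :=
  [multinom mxvec (\matrix_(i' < m, j' < n) ((i' == i :> nat) && (j' == j :> nat) : nat)) ord0 q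
  | q < m * n].

Lemma cellE (i : 'I_m) (j : 'I_n) i' j' :
  cell i' j' (mxvec_index i j) = (i == i' :> nat) && (j == j' :> nat).
Proof. by rewrite mnmE mxvecE mxE. Qed.

Lemma xx_cell i j : (i < m)%N -> (j < n)%N -> xx i j = 'X_[cell i j] :> S.
Proof.
move=> lti ltj; rewrite xxE; congr 'X_[_]; apply/mnmP => q.
case/mxvec_indexP: q => i' j'; rewrite cellE mnm1E.
rewrite /mxvec_index (inj_eq (@cast_ord_inj _ _ _)) (inj_eq enum_rank_inj) xpair_eqE.
by rewrite -!val_eqE /= ![(i == _)%N]eq_sym ![(j == _)%N]eq_sym.
Qed.

Lemma wt_cell i j : (i < m)%N -> (j < n)%N -> wt (cell i j) = (i.+1 * j.+1)%N.
Proof.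
move=> lti ltj; rewrite /wt (bigD1 (Ordinal lti)) //= (bigD1 (Ordinal ltj)) //=.
rewrite cellE !eqxx mul1n !big1 ?addn0 // => [i'|j'] /negPf; rewrite -val_eqE /= => ne.
  by rewrite big1 // => j' _; rewrite cellE ne.
by rewrite cellE ne andbF.
Qed.

Definition low (w : nat) f := forall v, v \in msupp f -> (wt v < w)%N.

(** Plays the part of a monic leading term. Distinct monomials may have equal weight, hence the
    strict bound on the remainder. *)
Definition tops u f := exists2 g, low (wt u) g & f = 'X_[u] + g.

Lemma lowD w f g : low w f -> low w g -> low w (f + g).
Proof. by move=> lf lg v /msuppD_le; rewrite mem_cat => /orP[/lf|/lg]. Qed.

Lemma lowN w f : low w f -> low w (- f).
Proof. by move=> lf v; rewrite (perm_mem (msuppN f)); apply: lf. Qed.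

Lemma low0 w : low w 0.
Proof. by move=> v; rewrite msupp0. Qed.

(** The successor in [low w1.+1] expresses weight at most [w1]: one strict bound is enough for a
    product. *)
Lemma lowM w1 w2 f g : low w1.+1 f -> low w2 g -> low (w1 + w2) (f * g).
Proof.
move=> lf lg v /msuppM_le /allpairsP[[v1 v2] /= [/lf l1 /lg l2 ->]].
by rewrite wtD -addnS leq_add.
Qed.

Lemma lowX u : low (wt u).+1 'X_[u].
Proof. by move=> v; rewrite msuppX inE => /eqP ->. Qed.

Lemma low_leq w1 w2 f : (w1 <= w2)%N -> low w1 f -> low w2 f.
Proof. by move=> le lf v /lf lt; apply: leq_trans le. Qed.

Lemma tops1 : tops 0%MM 1.
Proof. by exists 0; rewrite ?mpolyX0 ?addr0 //; apply: low0. Qed.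

Lemma topsM u v f g : tops u f -> tops v g -> tops (u + v)%MM (f * g).
Proof.
move=> [f' lf ->] [g' lg ->]; exists ('X_[u] * g' + f' * ('X_[v] + g')).
  rewrite wtD; apply: lowD; first by apply: lowM => //; apply: lowX.
  rewrite addnC mulrC; apply: lowM => //; apply: lowD; first exact: lowX.
  by apply: low_leq lg.
by rewrite mpolyXD mulrDl mulrDr addrA.
Qed.

Lemma tops_prod (I : eqType) (s : seq I) (u : I -> T) (F : I -> S) :
  (forall i, i \in s -> tops (u i) (F i)) ->
  tops (\sum_(i <- s) u i)%MM (\prod_(i <- s) F i).
Proof.
move=> uF; rewrite !big_seq; apply: (big_ind2 tops) => //; first exact: tops1.
by move=> *; apply: topsM.
Qed.

Lemma topsX u f e : tops u f -> tops (u *+ e)%MM (f ^+ e).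
Proof.
move=> uf; elim: e => [|e IH]; first by rewrite mulm0n; apply: tops1.
by rewrite mulmS exprS; apply: topsM.
Qed.

Lemma tops_coeff u f : tops u f -> f@_u = 1.
Proof.
case=> g lg ->; rewrite mcoeffD mcoeffX eqxx; case: (boolP (u \in msupp g)) => [/lg|].
  by rewrite ltnn.
by rewrite -mcoeff_eq0 => /eqP ->; rewrite addr0.
Qed.

Lemma tops_coeff0 u v f : tops u f -> (wt u < wt v)%N -> f@_v = 0.
Proof.
case=> g lg -> lt; rewrite mcoeffD mcoeffX; case: eqP => [e|_]; first by rewrite e ltnn in lt.
rewrite add0r; apply/eqP; rewrite mcoeff_eq0; apply/negP => /lg.
by rewrite ltnNge ltnW.
Qed.

Definition diag (x y s : nat) : T := (\sum_(a < s) cell (x + a) (y + a))%MM.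

Lemma tops_nminor x y s : (x + s <= m)%N -> (y + s <= n)%N ->
  tops (diag x y s) (nminor xx s (addn x) (addn y)).
Proof.
move=> lex ley; rewrite /nminor /determinant (bigD1 (perm_one _)) //= odd_perm1 expr0 mul1r.
have ltx (a : 'I_s) : (x + a < m)%N by apply: leq_trans lex; rewrite ltn_add2l.
have lty (a : 'I_s) : (y + a < n)%N by apply: leq_trans ley; rewrite ltn_add2l.
have prodE (sg : 'S_s) :
    \prod_i (\matrix_(a < s, b < s) (xx (x + a) (y + b) : S)) i (sg i) =
    'X_[(\sum_(a < s) cell (x + a) (y + sg a))%MM].
  rewrite (big_morph _ (@mpolyXD _ _) (@mpolyX0 _ _)).
  by apply: eq_bigr => a _; rewrite mxE xx_cell.
rewrite prodE; eexists; last first.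
  by congr ('X_[_] + _); apply: eq_bigr => a _; rewrite perm1.
apply: (big_ind (low _)); [exact: low0 | exact: lowD |] => sg ne1.
rewrite prodE; set v := (\sum_(a < s) _)%MM.
have lv : low (wt (diag x y s)) ('X_[v] : S).
  apply: (@low_leq (wt v).+1); last exact: lowX.
  rewrite !wt_sum.
  rewrite (eq_bigr _ (fun a _ => wt_cell (ltx a) (lty (sg a)))).
  rewrite (eq_bigr _ (fun a _ => wt_cell (ltx a) (lty a))).
  exact: (sum_perm_lt x.+1 y.+1 ne1).
by case: (odd_perm sg); rewrite ?expr1 ?expr0 ?mulN1r ?mul1r //; apply: lowN.
Qed.

End Weights.

(** * Counting over the factors of [Delta] *)

Lemma sum_nat_eq1 lo hi t (P : nat -> bool) :
  (forall c, (lo <= c < hi)%N -> P c = (c == t)) ->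
  (\sum_(lo <= c < hi) P c = (lo <= t < hi))%N.
Proof.
move=> PE; rewrite (eq_big_nat _ _ (fun c lc => congr1 nat_of_bool (PE c lc))).
elim: hi {PE} => [|hi IH]; first by rewrite big_geq // ltn0 andbF.
case: (leqP lo hi) => [le|lt]; last by rewrite big_geq //; lia.
by rewrite big_nat_recr //= IH; lia.
Qed.

Lemma sum_ltn_minn s q : (\sum_(a < s) (a < q) = minn s q)%N.
Proof. by elim: s => [|s IH]; rewrite ?big_ord0 ?min0n // big_ord_recr /= IH; lia. Qed.

(** Doubling avoids a division and matches the use, where the [alpha] and the [beta] contribute the
    same sum. *)
Lemma sum_subn_nat mu r :
  (2 * \sum_(1 <= i < mu) (i - r) = (mu - r) * (mu - r).-1)%N.
Proof.
elim: mu => [|mu IH]; first by rewrite big_geq.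
case: mu IH => [|mu] IH; first by rewrite big_geq //; case: r {IH} => [|r].
by rewrite big_nat_recr //= mulnDr IH; nia.
Qed.

Section Delta.
Variables (k : fieldType) (m n : nat).
Local Notation S := {mpoly k[m * n]}.
Local Notation mu := (minn m n).

Lemma diagE (i : 'I_m) (j : 'I_n) x y s :
  diag m n x y s (mxvec_index i j) = [&& (y <= j)%N, (j < y + s)%N & (i + y == x + j)%N] :> nat.
Proof.
rewrite /diag mnm_sumE; under eq_bigr do rewrite cellE.
elim: s => [|s IH]; first by rewrite big_ord0; lia.
by rewrite big_ord_recr /= IH; lia.
Qed.

Definition ones : 'X_{1..m * n} := [multinom 1%N | _ < m * n].

(** The difference [j - i] decides the factor: the [alpha] cover the short diagonals at the lower
    left, the [beta] those at the upper right, and the [delta] the diagonals of full length [mu]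
    between them. *)
Lemma diag_sum_ones :
  (\sum_(1 <= i < mu) diag m n (m - i) 0 i
   + \sum_(1 <= j < ((n - m) + (m - n)).+2)
        (if (m <= n)%N then diag m n 0 j.-1 mu else diag m n j.-1 0 mu)
   + \sum_(1 <= i < mu) diag m n 0 (n - i) i = ones)%MM.
Proof.
apply/mnmP => q; case/mxvec_indexP: q => i j.
have lti := ltn_ord i; have ltj := ltn_ord j.
rewrite !mnmDE !mnm_sumE mnmE.
rewrite (eq_bigr _ (fun c _ => diagE i j (m - c) 0 c)).
rewrite [X in (_ + X)%N](eq_bigr _ (fun c _ => diagE i j 0 (n - c) c)).
(* Solving for the size gives one candidate in each family; it counts only if it lies in the range
   of the product. *)
rewrite (@sum_nat_eq1 _ _ (m + j - i)%N) => [|c]; last by lia.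
rewrite [X in (_ + X)%N](@sum_nat_eq1 _ _ (n + i - j)%N) => [|c]; last by lia.
case: (leqP m n) => [lemn|ltnm] /=.
  rewrite (eq_bigr _ (fun c _ => diagE i j 0 c.-1 m)).
  by rewrite (@sum_nat_eq1 _ _ (j.+1 - i)%N) => [|c]; lia.
rewrite (eq_bigr _ (fun c _ => diagE i j c.-1 0 n)).
by rewrite (@sum_nat_eq1 _ _ (i.+1 - j)%N) => [|c]; lia.
Qed.

Lemma tops_Delta : tops ones (Delta k m n).
Proof.
rewrite -diag_sum_ones /Delta; apply: topsM; first apply: topsM.
- apply: tops_prod => i; rewrite mem_index_iota => lti.
  by apply: tops_nminor; lia.
- apply: tops_prod => j; rewrite mem_index_iota => ltj; rewrite /delta.
  by case: leqP => lemn; apply: tops_nminor; lia.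
- apply: tops_prod => i; rewrite mem_index_iota => lti.
  by apply: tops_nminor; lia.
Qed.

Lemma phi_map1 p rt : p \in [pchar k] -> (forall c : k, rt c ^+ p = c) ->
  phi_map k m n p rt 1 = 1.
Proof.
move=> charp rtK; rewrite /phi_map mulr1; apply/mpolyP => u.
rewrite (frob_trace_coeff charp rtK) mcoeff1.
have top := topsX p.-1 tops_Delta.
have e0 : trace_mnm p 0%MM = (ones *+ p.-1)%MM.
  by apply/mnmP => q; rewrite mulmnE !mnmE mul1n.
case: (eqVneq u 0%MM) => [->|ne0].
  by rewrite e0 (tops_coeff top) (rt1 charp rtK).
(* For nonzero [u] the exponent [trace_mnm p u] has larger weight than the top exponent of the power
   of [Delta]. *)
rewrite (tops_coeff0 top) ?(rt0 charp rtK) // -e0 -[u]addm0 trace_mnmD wtD.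
rewrite -{1}[wt _]add0n ltn_add2r -(prednK (prime_gt0 (pcharf_prime charp))) mulmS wtD.
by rewrite ltn_addr // wt_gt0.
Qed.

Lemma local_idpow_consec r x y s : (x + s <= m)%N -> (y + s <= n)%N ->
  local_idpow m r (s - r) (nminor xx s (addn x) (addn y) : S).
Proof.
move=> lex ley; case: (leqP s r) => [/eqP -> |ltr]; first exact: local_idpow0.
apply: local_idpow_nminor => [b ltb|]; first by apply: leq_trans ley; rewrite ltn_add2l.
rewrite (eq_bigr (fun=> 1%N)) => [|a _]; last first.
  by rewrite (leq_trans _ lex) // ltn_add2l.
by rewrite sum_nat_const card_ord muln1 subnK // ltnW.
Qed.

(** The exponents add up to [(mu-r)(mu-r-1) + (|n-m|+1)(mu-r)], which equals [(m-r)(n-r)]. *)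
Lemma local_idpow_Delta r : (r < mu)%N ->
  local_idpow m r ((m - r) * (n - r)) (Delta k m n).
Proof.
move=> ltr; rewrite /Delta.
apply: (@local_idpow_leq _ _ _ _ _ _ (\sum_(1 <= i < mu) (i - r) +
  \sum_(1 <= j < ((n - m) + (m - n)).+2) (mu - r) + \sum_(1 <= i < mu) (i - r))%N).
  have := sum_subn_nat mu r; rewrite sum_nat_const_nat.
  move: (\sum_(1 <= i < mu) _)%N => A; move: ltr; rewrite /minn.
  by case: (ltnP m n) => lemn ltr; nia.
apply: local_idpowM; first apply: local_idpowM.
- apply: local_idpow_prod => i; rewrite mem_index_iota => lti.
  by apply: local_idpow_consec; lia.
- apply: local_idpow_prod => j; rewrite mem_index_iota => ltj; rewrite /delta.
  by case: leqP => lemn; apply: local_idpow_consec; lia.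
- apply: local_idpow_prod => i; rewrite mem_index_iota => lti.
  by apply: local_idpow_consec; lia.
Qed.

Lemma local_idpow_top r y s : (r < s)%N -> (y + s <= n)%N ->
  local_idpow r.+1 r 1 (nminor xx s (addn 0) (addn y) : S).
Proof.
move=> ltr ley.
apply: local_idpow_nminor => [b ltb|]; first by apply: leq_trans ley; rewrite ltn_add2l.
by rewrite (sum_ltn_minn s r.+1) leq_min ltr ltnSn.
Qed.

(** A factor of size above [r] that starts in the first row contributes 1. These are [mu-r-1] of the
    [beta], together with all [n-m+1] of the [delta] if [m <= n] and only the first one otherwise:
    [n-r] in total. *)
Lemma local_idpow_Delta_top r : (r < mu)%N ->
  local_idpow r.+1 r ((r.+1 - r) * (n - r)) (Delta k m n).
Proof.
move=> ltr; rewrite /Delta.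
pose w j : nat := (m <= n)%N || (j == 1%N).
apply: (@local_idpow_leq _ _ _ _ _ _ (0 +
  \sum_(1 <= j < ((n - m) + (m - n)).+2) w j + \sum_(1 <= i < mu) (r < i))%N).
  have -> : (\sum_(1 <= i < mu) (r < i) = mu - r.+1)%N.
    elim: (mu) => [|q IH]; first by rewrite big_geq.
    case: q IH => [|q] IH; first by rewrite big_geq //; lia.
    by rewrite big_nat_recr //= IH; lia.
  rewrite /w; case: (leqP m n) => lemn /=.
    by rewrite sum_nat_const_nat; lia.
  by rewrite (@sum_nat_eq1 _ _ 1) //; lia.
apply: local_idpowM; first apply: local_idpowM.
- exact: local_idpow0.
- apply: local_idpow_prod => j; rewrite mem_index_iota => ltj; rewrite /delta /w.
  case: leqP => lemn /=; first by apply: local_idpow_top; lia.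
  by case: eqP => [->|_]; [apply: local_idpow_top; lia | apply: local_idpow0].
- apply: local_idpow_prod => i; rewrite mem_index_iota => lti.
  by case: ltnP => ltri; [apply: local_idpow_top; lia | apply: local_idpow0].
Qed.

End Delta.

Unset Implicit Arguments.

Theorem theorem4p3 (k : fieldType) (p : nat) (rt : k -> k) (m n : nat) :
  p \in [pchar k] ->
  (forall c : k, rt c ^+ p = c) ->
  phi_map k m n p rt 1 = 1 /\
  (forall t : nat, (2 <= t <= minn m n)%N ->
     compatible (phi_map k m n p rt) (It t (xmat k m n)) /\
     compatible (phi_map k m n p rt) (It t.-1 (firstRows t.-1 (xmat k m n)))).
Proof.
move=> charp rtK; split; first exact: phi_map1.
have p_gt0 := prime_gt0 (pcharf_prime charp).
have compat q r : (q <= m)%N -> (r <= q)%N -> (r <= n)%N ->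
    local_idpow q r ((q - r) * (n - r)) (Delta k m n) ->
    compatible (phi_map k m n p rt) (in_ideal (@top_minor k m n q r)).
  by move=> *; apply: compatible_top_minor => //;
    [exact: frob_traceD | exact: frob_traceM].
case=> [|[|r]] // /andP[_]; rewrite leq_min => /andP[ltrm ltrn] /=; split=> f.
  have xE i j : xmat k m n i j = xx i j by rewrite mxE xx_ord.
  move/(It_top_minor r.+1 f xE) => If; apply/(It_top_minor r.+1 _ xE).
  have IDelta : local_idpow m r.+1 ((m - r.+1) * (n - r.+1)) (Delta k m n).
    by apply: local_idpow_Delta; rewrite leq_min ltrm.
  exact: compat (leqnn m) (ltnW ltrm) (ltnW ltrn) IDelta _ If.
have minrm : minn r.+1 m = r.+1 by apply/minn_idPl/ltnW.
have xE i j : firstRows r.+1 (xmat k m n) i j = xx i j.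
  by rewrite mxE mxE -xx_ord.
have IDelta : local_idpow r.+1 r ((r.+1 - r) * (n - r)) (Delta k m n).
  by apply: local_idpow_Delta_top; rewrite leq_min (ltnW ltrm) (ltnW ltrn).
move/(It_top_minor r f xE) => If; apply/(It_top_minor r _ xE); move: If; rewrite minrm.
exact: (compat _ _ (ltnW ltrm) (leqnSn r) (ltnW (ltnW ltrn)) IDelta).
Qed.
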